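(* Let $n\ge 1$ and let $a,b$ be positive integers. Write $\frac{a}{b}=\frac{q}{p}$ with $p,q$ relatively prime positive integers. There exists an open dense subset $U$ of $\mathcal{P}_a\times\mathcal{P}_b$ such that for every $(F,G)\in U$: (1) $\{F=0\}$ and $\{G=0\}$ are smooth varieties in $\mathbb{C}P(n)$ and intersect each other transversally; (2) the restriction of $f=\frac{F^p}{G^q}$ to $\mathbb{C}P(n)\setminus(\{F=0\}\cup\{G=0\})$ has only nondegenerate critical points $p_1,\dots,p_r$, and their images $c_1=f(p_1),\dots,c_r=f(p_r)$ in $\overline{\mathbb{C}}$ are distinct.
   Context: $\mathcal{P}_a$ denotes the set (complex vector space) of homogeneous polynomials of degree $a$ on $\mathbb{C}^{n+1}$, i.e. in the variables $x_0,\dots,x_n$. $\overline{\mathbb{C}}=\mathbb{C}\cup\{\infty\}$ is the Riemann sphere. For $F\in\mathcal{P}_a$, $G\in\mathcal{P}_b$ with $a/b=q/p$, the function $f=\frac{F^p}{G^q}:\mathbb{C}P(n)\setminus(\{F=0\}\cap\{G=0\})\to\overline{\mathbb{C}}$, $f(x)=F(x)^p/G(x)^q$, is well defined since $F^p$ and $G^q$ have the same degree. *)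

(* Defs.v *)
From HB Require Import structures.
From mathcomp Require Import all_boot all_order all_algebra generic_quotient.
From mathcomp Require Import all_classical all_reals all_analysis.
From mathcomp Require Import complex.
(* The notations of mpoly clash with those of MathComp-Analysis. *)
From mathcomp Require Import -(notations) mpoly.
Import numFieldNormedType.Exports.
Import Order.TTheory GRing.Theory Num.Theory.

Set Implicit Arguments.
Unset Strict Implicit.
Unset Printing Implicit Defensive.

Local Open Scope classical_set_scope.
Local Open Scope ring_scope.
Local Open Scope quotient_scope.

(* The type R[i] itself is not in the topological hierarchy; as a
   numClosedFieldType it receives the topology of the modulus. *)
Definition cplx (R : realType) : numClosedFieldType := R[i].

Section HomogeneousPolynomials.
Variables (R : realType) (n : nat).
Local Notation C := (cplx R).

Definition coeffs (a : nat) (F : dhomog n.+1 C a) :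
    prod_topology (fun _ : multinom n.+1 => C : topologicalType) :=
  fun m => mcoeff m (mpoly_of_dhomog F).

(* Only the finitely many coefficients of total degree a can be nonzero, so this
   is the usual topology of a finite-dimensional complex vector space. *)
Definition homog_poly (a : nat) := initial_topology (@coeffs a).

Definition heval (a : nat) (F : homog_poly a) (x : 'rV[C]_n.+1) : C :=
  meval (fun j => x 0 j) (mpoly_of_dhomog F).

Lemma hevalZ (a : nat) (F : homog_poly a) (c : C) (x : 'rV[C]_n.+1) :
  heval F (c *: x) = c ^+ a * heval F x.
Proof.
rewrite /heval !mevalE mulr_sumr; apply: eq_big_seq => m mF.
have ma : mdeg m = a by have /dhomogP := dhomog_is_dhomog F; apply.
rewrite mulrCA; congr (_ * _).
under eq_bigr do rewrite mxE exprMn.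
by rewrite big_split /= prodrXr -mdegE ma.
Qed.

End HomogeneousPolynomials.

Section ProjectiveSpace.
Variables (R : realType) (n : nat).
Local Notation C := (cplx R).

Definition nzvec := {x : 'rV[C]_n.+1 | x != 0}.

Definition same_line : rel nzvec :=
  fun x y => `[< exists2 c : C, c != 0 & val y = c *: val x >].

Lemma same_line_refl : reflexive same_line.
Proof. by move=> x; apply/asboolP; exists 1; rewrite ?oner_neq0 ?scale1r. Qed.

Lemma same_line_sym : ssrbool.symmetric same_line.
Proof.
move=> x y; apply/asboolP/asboolP => -[c c0 ->];
by exists c^-1; rewrite ?invr_eq0// scalerA mulVf// scale1r.
Qed.

Lemma same_line_trans : transitive same_line.
Proof.
move=> y x z /asboolP[c c0 yx] /asboolP[d d0 zy]; apply/asboolP.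
by exists (d * c); rewrite ?mulf_neq0// zy yx scalerA.
Qed.

Canonical same_line_equiv :=
  EquivRel same_line same_line_refl same_line_sym same_line_trans.

Definition CP := {eq_quot same_line_equiv}.

(* Homogeneous coordinates of a point, up to a nonzero scalar. *)
Definition hcoord (x : CP) : 'rV[C]_n.+1 := val (repr x).

(* The affine point z, with a coordinate 1 inserted at place i. *)
Definition chart_vec (i : 'I_n.+1) (z : 'rV[C]_n) : 'rV[C]_n.+1 :=
  \row_j if unlift i j is Some k then z 0 k else 1.

Lemma chart_vec_neq0 i z : chart_vec i z != 0.
Proof.
apply/eqP => /rowP /(_ i); rewrite !mxE unlift_none => /eqP.
by rewrite oner_eq0.
Qed.

(* The standard parametrization of the open set {x_i <> 0} by C^n. *)
Definition chart (i : 'I_n.+1) (z : 'rV[C]_n) : CP :=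
  \pi_CP (Sub (chart_vec i z) (chart_vec_neq0 i z) : nzvec).

Lemma hcoord_pi (x : nzvec) :
  exists2 c : C, c != 0 & hcoord (\pi_CP x) = c *: val x.
Proof.
have /eqquotP : x = repr (\pi_CP x) %[mod CP] by rewrite reprK.
by move/asboolP.
Qed.

Lemma chart_cover (x : CP) : exists i z, chart i z = x.
Proof.
have /rV0Pn[i xi0] := valP (repr x).
exists i, (\row_k ((hcoord x 0 i)^-1 * hcoord x 0 (lift i k))).
rewrite -[RHS]reprK; apply/eqquotP/asboolP; exists (hcoord x 0 i) => //.
apply/rowP => j; rewrite !mxE; case: unliftP => [k ->|->] /=; last first.
  by rewrite mulr1.
by rewrite !mxE mulrA mulfV ?mul1r.
Qed.

End ProjectiveSpace.
Arguments chart {R n}.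
Arguments chart_vec {R n}.

Section Hypersurfaces.
Variables (R : realType) (n : nat).
Local Notation C := (cplx R).

Definition zero_locus (a : nat) (F : homog_poly R n a) : set (CP R n) :=
  [set x | heval F (hcoord x) = 0].

Definition dehomog (a : nat) (F : homog_poly R n a) (i : 'I_n.+1)
  (z : 'rV[C]_n) : C := heval F (chart_vec i z).

Lemma zero_locus_chart (a : nat) (F : homog_poly R n a) i z :
  zero_locus F (chart i z) <-> dehomog F i z = 0.
Proof.
rewrite /zero_locus /dehomog /=.
have [c c0 ->] := hcoord_pi (Sub (chart_vec i z) (chart_vec_neq0 i z)).
rewrite hevalZ /=; split=> [/eqP|->]; last by rewrite mulr0.
by rewrite mulf_eq0 expf_eq0 (negPf c0) andbF => /eqP.
Qed.

(* Jacobian criterion for the hypersurface defined by the equation F. *)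
Definition smooth_hypersurface (a : nat) (F : homog_poly R n a) : Prop :=
  forall i z, zero_locus F (chart i z) ->
    exists v : 'rV[C]_n, 'd (dehomog F i) z v != 0.

(* The tangent space to {F = 0} at chart i z, read in the chart i. *)
Definition tangent_space (a : nat) (F : homog_poly R n a) (i : 'I_n.+1)
  (z : 'rV[C]_n) : set 'rV[C]_n := [set v | 'd (dehomog F i) z v = 0].

Definition meet_transversally (a b : nat) (F : homog_poly R n a)
    (G : homog_poly R n b) : Prop :=
  forall i z, zero_locus F (chart i z) -> zero_locus G (chart i z) ->
    forall w, exists u v,
      [/\ tangent_space F i z u, tangent_space G i z v & w = u + v].

End Hypersurfaces.

Section Ratio.
Variables (R : realType) (n : nat).
Local Notation C := (cplx R).

(* None is the point at infinity. *)
Definition riemann_sphere : Type := one_point_compactification C.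

(* The value at infinity is 0 by convention; the coordinate is only used near
   finite points. *)
Definition affine_coord (w : riemann_sphere) : C := odflt 0 w.

Variables (a b p q : nat) (F : homog_poly R n a) (G : homog_poly R n b).

(* The map F^p / G^q; its value on {F = 0} `&` {G = 0} is irrelevant. *)
Definition ratio_map (x : CP R n) : riemann_sphere :=
  if heval G (hcoord x) == 0 then None
  else Some (heval F (hcoord x) ^+ p / heval G (hcoord x) ^+ q).

(* The value does not depend on the choice of homogeneous coordinates. *)
Lemma ratio_map_pi (x : nzvec R n) : (a * p = b * q)%N ->
  ratio_map (\pi_(CP R n) x) =
  if heval G (val x) == 0 then None
  else Some (heval F (val x) ^+ p / heval G (val x) ^+ q).
Proof.
move=> abpq; rewrite /ratio_map; have [c c0 ->] := hcoord_pi x.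
rewrite !hevalZ mulf_eq0 expf_eq0 (negPf c0) andbF /=.
case: ifP => // _; congr Some.
by rewrite !exprMn -!exprM abpq -mulf_div divff ?mul1r// expf_neq0.
Qed.

Definition ratio_chart (i : 'I_n.+1) (z : 'rV[C]_n) : C :=
  affine_coord (ratio_map (chart i z)).

Definition hessian (h : 'rV[C]_n -> C) (z : 'rV[C]_n) : 'M[C]_n :=
  \matrix_(j, k) 'D_(delta_mx 0 j) ('D_(delta_mx 0 k) h) z.

(* Critical points of the restriction to the complement of
   {F = 0} `|` {G = 0}. *)
Definition critical_points : set (CP R n) :=
  [set x | [/\ ~ zero_locus F x, ~ zero_locus G x &
    forall i z, chart i z = x -> forall v, 'd (ratio_chart i) z v = 0]].

Definition nondegenerate_at (x : CP R n) : Prop :=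
  forall i z, chart i z = x -> \det (hessian (ratio_chart i) z) != 0.

End Ratio.

(* Main.v *)
(* All bad loci are shown to be thin, i.e. contained in the zero set of a nonzero
   polynomial in the coefficients of (F, G); its nonvanishing locus is open and
   dense.  Thinness is a dimension count: if more linear conditions are
   imposed on (F, G) than there are parameters in the conditions, and if these
   are independent for every value of the parameters, then Cramer's rule exhibits
   the coefficients of (F, G) as rational functions of fewer variables, and N
   rational functions of fewer than N variables are algebraically dependent.

   Each degeneracy is of this form.  At a critical point x, put rho = G(x)/F(x);
   then G(x) = rho F(x) and q dG(x) = p rho dF(x) are linear in (F, G).  Adding a
   coordinate of x to the unknowns gives an equation for that coordinate, whence
   finiteness.  A kernel vector of the Hessian gives n more linear conditions,
   with n parameters: its direction and dF(x).u / F(x), the latter subject to a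
   linear condition of its own.  If x and y are critical with the same value,
   then, p and q being coprime, F(y) = mu^q F(x) and G(y) = mu^p G(x) for some mu.
   The independence of these conditions is interpolation of jets, available for
   one 2-jet if max(a, b) > 1 and for two 1-jets if max(a, b) > 2.  In lower
   degrees dF and dG are affine and a bad pair has a line of critical points. *)

Require Import Defs.
From HB Require Import structures.
From mathcomp Require Import all_boot all_order all_algebra generic_quotient.
From mathcomp Require Import all_classical all_reals all_analysis.
From mathcomp Require Import complex.
From mathcomp Require Import -(notations) mpoly.
From mathcomp Require Import zify ring.
Import numFieldNormedType.Exports.
Import Order.TTheory GRing.Theory Num.Theory.

Set Implicit Arguments.
Unset Strict Implicit.
Unset Printing Implicit Defensive.

Local Open Scope classical_set_scope.
Local Open Scope ring_scope.

Local Notation msize p := (mmeasure mdeg p).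

(** * Algebraic dependence *)

Section AlgebraicDependence.
Variable K : numFieldType.

Lemma poly_nonroot (p : {poly K}) : p != 0 -> exists x, p.[x] != 0.
Proof.
move=> p0; apply: contrapT => H.
have := max_poly_roots p0 (rs := [seq i%:R | i <- iota 0 (size p)]).
rewrite size_map size_iota ltnn; move=> h; suff : false by []; apply: h.
  apply/allP => x _; apply/rootP; apply: contrapT => /eqP px.
  by apply: H; exists x.
by rewrite map_inj_uniq ?iota_uniq//; move=> i j /eqP; rewrite eqr_nat => /eqP.
Qed.

(** Reduction modulo [D] isolates the lowest digit and division by [D] leaves the others. This makes
    the Kronecker substitution in [monomial_comb_nonroot] injective on monomials. *)
Lemma digits_inj N D (a b : 'I_N -> nat) :
  (forall k, a k < D)%N -> (forall k, b k < D)%N ->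
  (\sum_k a k * D ^ k = \sum_k b k * D ^ k)%N -> a =1 b.
Proof.
elim: N a b => [|N IH] a b aD bD; first by move=> _ [].
rewrite !big_ord_recl /= !expn0 !muln1.
have tailE (c : 'I_N.+1 -> nat) :
    (\sum_(i < N) c (lift ord0 i) * D ^ bump 0 i =
     (\sum_(i < N) c (lift ord0 i) * D ^ i) * D)%N.
  by rewrite big_distrl; apply: eq_bigr => i _; rewrite /= expnSr mulnA.
rewrite !tailE => E.
have D0 : (0 < D)%N by exact: leq_ltn_trans (leq0n _) (aD ord0).
have E0 : a ord0 = b ord0.
  by have := congr1 (modn^~ D) E; rewrite ![(_ + _ * D)%N]addnC !modnMDl !modn_small.
move: E; rewrite E0 => /addnI /eqP; rewrite eqn_mul2r eqn0Ngt D0 /= => /eqP E.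
move=> k; have [->//|[j ->]] : k = ord0 \/ exists j, k = lift ord0 j.
  by case: (unliftP ord0 k) => [j ->|->]; [right; exists j|left].
exact: (IH (fun j => a (lift ord0 j)) (fun j => b (lift ord0 j))).
Qed.

(** A crude count suffices: each of the [M] exponents is at most the total degree, hence below
    [B]. *)
Lemma card_bmultinom M B : (#|{: bmultinom M B}| <= B ^ M)%N.
Proof.
case: B => [|B].
  by rewrite eq_card0// => m; have := bmdeg m; rewrite ltn0.
have mB (m : bmultinom M B.+1) k : (bmnm m k < B.+1)%N.
  apply: leq_ltn_trans (bmdeg m); rewrite mdegE (bigD1 k)//=.
  exact: leq_addr.
pose f (m : bmultinom M B.+1) : {ffun 'I_M -> 'I_B.+1} :=
  [ffun k => Ordinal (mB m k)].
have fI : injective f.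
  move=> m m' /ffunP E; apply/val_inj/mnmP => k.
  by have := congr1 val (E k); rewrite !ffunE.
by have := leq_card f fI; rewrite card_ffun !card_ord.
Qed.

Lemma msize_prod_le M (I : Type) (s : seq I) (h : I -> mpoly M K) (d : I -> nat) :
  (forall i, msize (h i) <= d i)%N ->
  (msize (\prod_(i <- s) h i) <= (\sum_(i <- s) (d i).+1).+1)%N.
Proof.
move=> hd; elim: s => [|i s IH]; first by rewrite !big_nil msize1.
rewrite !big_cons (leq_trans (msizeM_le _ _))// ltnS addSn -addnS.
exact: leq_add.
Qed.

Lemma msize_exp_le M (h : mpoly M K) d k :
  (msize h <= d)%N -> (msize (h ^+ k) <= (k * d.+1).+1)%N.
Proof.
move=> hd; have := @msize_prod_le M nat (iota 0 k) (fun=> h) (fun=> d).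
by rewrite !big_const_seq count_predT size_iota iter_mulr_1 iter_addn_0 mulnC; apply.
Qed.

Lemma wide_linear_dependence (I J : finType) (A : I -> J -> K) :
  (#|J| < #|I|)%N ->
  exists c : I -> K, (exists i, c i != 0) /\ forall j, \sum_i c i * A i j = 0.
Proof.
move=> JI; pose B := \matrix_(i < #|I|, j < #|J|) A (enum_val i) (enum_val j).
have : kermx B != 0.
  rewrite kermx_eq0; apply/negP => /eqP E.
  by have := rank_leq_col B; rewrite E leqNgt JI.
case/rowV0Pn => v /sub_kermxP vB /rV0Pn[i vi].
exists (fun i => v 0 (enum_rank i)); split.
  by exists (enum_val i); rewrite enum_valK.
move=> j; have := congr1 (fun u : 'rV_#|J| => u 0 (enum_rank j)) vB; rewrite !mxE => E.
rewrite -[RHS]E (reindex (@enum_val I predT)) /=; last first.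
  exact/onW_bij/enum_val_bij.
by apply: eq_bigr => k _; rewrite mxE enum_valK enum_rankK.
Qed.

(* Counting: [D ^ N] products of the [h k], homogenized by powers of [g], against
   at most [(e * D) ^ M] coefficients. *)
Lemma algebraic_dependence M N (h : 'I_N -> mpoly M K) (g : mpoly M K) :
  (M < N)%N ->
  exists (D : nat) (c : {ffun 'I_N -> 'I_D} -> K),
    (exists a, c a != 0) /\
    forall (s : 'I_M -> K) (y : 'I_N -> K), meval s g != 0 ->
      (forall k, meval s g * y k = meval s (h k)) ->
      \sum_a c a * \prod_k y k ^+ a k = 0.
Proof.
move=> MN.
pose d := (maxn (msize g) (\max_k msize (h k))).
have gd : (msize g <= d)%N by rewrite leq_maxl.
have hd k : (msize (h k) <= d)%N.
  by rewrite (leq_trans _ (leq_maxr _ _))// leq_bigmax.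
(* [e] does not depend on [D] and makes every [H a] below of size at most [e * D]. Since [D] exceeds
   [e ^ M], there are fewer coefficients, at most [(e * D) ^ M], than products, at least
   [D ^ M.+1]. *)
pose e := (N * (d.+1 + d.+1 + 4)).+2.
pose D := (e ^ M).+1.
pose H (a : {ffun 'I_N -> 'I_D}) := \prod_k (h k ^+ a k * g ^+ (D - a k)).
have He a : (msize (H a) <= e * D)%N.
  pose w := (D * d.+1 + D * d.+1 + 3)%N.
  have term k : (msize (h k ^+ a k * g ^+ (D - a k)) <= w)%N.
    have h1 : (msize (h k ^+ a k) <= (D * d.+1).+1)%N.
      rewrite (leq_trans (msize_exp_le _ (hd k)))// ltnS leq_mul2r.
      by rewrite (ltnW (ltn_ord _)) orbT.
    have h2 : (msize (g ^+ (D - a k)) <= (D * d.+1).+1)%N.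
      by rewrite (leq_trans (msize_exp_le _ gd))// ltnS leq_mul2r leq_subr orbT.
    rewrite (leq_trans (msizeM_le _ _))// /w.
    by move: h1 h2; lia.
  apply: leq_trans (msize_prod_le _ term) _.
  rewrite big_const_ord iter_addn_0 /w /e.
  have : (0 < D)%N by []. 
  move: (D) => D'; nia.
have cnt : (#|{: bmultinom M (e * D)}| < #|{: {ffun 'I_N -> 'I_D}}|)%N.
  apply: leq_ltn_trans (card_bmultinom _ _) _.
  rewrite card_ffun !card_ord expnMn.
  apply: (@leq_trans (D ^ M.+1)); last by rewrite leq_pexp2l.
  by rewrite expnS ltn_pmul2r ?expn_gt0.
have [c [c0 cH]] := wide_linear_dependence
  (fun a (m : bmultinom M (e * D)) => mcoeff (bmnm m) (H a)) cnt.
exists D, c; split => // s y g0 hy.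
have : \sum_a c a *: H a = 0.
  apply/mpolyP => m; rewrite mcoeff0 raddf_sum /=.
  under eq_bigr do rewrite mcoeffZ.
  have [meD|meD] := ltnP (mdeg m) (e * D); first exact: (cH (BMultinom meD)).
  rewrite big1// => a _; rewrite memN_msupp_eq0 ?mulr0//.
  exact: msize_mdeg_ge (leq_trans (He a) meD).
(* At [s] the k-th factor of [H a] becomes [g ^+ D * y k ^+ a k]; the power of [g] is the same for
   all [a] and cancels. *)
move/(congr1 (meval s)); rewrite raddf_sum meval0 /=.
under eq_bigr => a _.
  rewrite mevalZ /H rmorph_prod /=.
  under eq_bigr => k _.
    rewrite mevalM !rmorphXn /= -hy exprMn mulrAC -exprD subnKC ?(ltnW (ltn_ord _))//.
    over.
  rewrite big_split /= mulrCA.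
  over.
rewrite -mulr_sumr => /eqP; rewrite mulf_eq0 => /orP[/prodf_eq0[k _]|/eqP//].
by rewrite expf_eq0 (negPf g0) andbF.
Qed.
End AlgebraicDependence.

Import VectorInternalTheory.

(** * Thin sets *)

Section PolynomialFunctions.
Variable K : numFieldType.

(** Polynomial functions without a choice of basis, so that closure properties follow by induction
    and apply to products of spaces directly. *)
Inductive polyfun (V : lmodType K) : (V -> K) -> Prop :=
| polyfun_cst c : polyfun (fun=> c)
| polyfun_lin (l : V -> K) : scalar l -> polyfun l
| polyfunD f g : polyfun f -> polyfun g -> polyfun (fun v => f v + g v)
| polyfunM f g : polyfun f -> polyfun g -> polyfun (fun v => f v * g v).

Section Closure.
Variable V : lmodType K.
Implicit Types f g : V -> K.

Lemma polyfunN f : polyfun f -> polyfun (fun v => - f v).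
Proof.
move=> pf; rewrite (_ : (fun _ => _) = fun v => -1 * f v); last first.
  by apply/funext => v; rewrite mulN1r.
by apply: polyfunM => //; exact: polyfun_cst.
Qed.

Lemma polyfunB f g : polyfun f -> polyfun g -> polyfun (fun v => f v - g v).
Proof. by move=> pf pg; apply: polyfunD => //; exact: polyfunN. Qed.

Lemma polyfunX f k : polyfun f -> polyfun (fun v => f v ^+ k).
Proof.
move=> pf; elim: k => [|k IH].
  by rewrite (_ : (fun _ => _) = fun=> 1)//; exact: polyfun_cst.
rewrite (_ : (fun _ => _) = fun v => f v * f v ^+ k); first exact: polyfunM.
by apply/funext => v; rewrite exprS.
Qed.

Lemma polyfun_sum (I : Type) (s : seq I) (P : pred I) (f : I -> V -> K) :
  (forall i, polyfun (f i)) -> polyfun (fun v => \sum_(i <- s | P i) f i v).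
Proof.
move=> pf; elim: s => [|i s IH].
  rewrite (_ : (fun _ => _) = fun=> 0); first exact: polyfun_cst.
  by apply/funext => v; rewrite big_nil.
rewrite (_ : (fun _ => _) =
    fun v => (if P i then f i v else 0) + \sum_(i <- s | P i) f i v).
  by apply: polyfunD => //; case: (P i) => //; exact: polyfun_cst.
by apply/funext => v; rewrite big_cons; case: (P i); rewrite ?add0r.
Qed.

Lemma polyfun_prod (I : Type) (s : seq I) (P : pred I) (f : I -> V -> K) :
  (forall i, polyfun (f i)) -> polyfun (fun v => \prod_(i <- s | P i) f i v).
Proof.
move=> pf; elim: s => [|i s IH].
  rewrite (_ : (fun _ => _) = fun=> 1); first exact: polyfun_cst.
  by apply/funext => v; rewrite big_nil.
rewrite (_ : (fun _ => _) =
    fun v => (if P i then f i v else 1) * \prod_(i <- s | P i) f i v).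
  by apply: polyfunM => //; case: (P i) => //; exact: polyfun_cst.
by apply/funext => v; rewrite big_cons; case: (P i); rewrite ?mul1r.
Qed.

Lemma polyfun_comp (W : lmodType K) (h : W -> V) f :
  (forall l : V -> K, scalar l -> polyfun (l \o h)) ->
  polyfun f -> polyfun (f \o h).
Proof.
move=> hl; elim=> [c|l|{}f g _ pf _ pg|{}f g _ pf _ pg].
- exact: polyfun_cst.
- exact: hl.
- exact: polyfunD.
- exact: polyfunM.
Qed.

Lemma polyfun_affine (W : lmodType K) (h : W -> V) (v0 : V) f :
  linear h -> polyfun f -> polyfun (fun w => f (v0 + h w)).
Proof.
move=> hl; apply: (@polyfun_comp _ (fun w => v0 + h w)) => l ll.
rewrite (_ : _ \o _ = fun w => l v0 + l (h w)).
  apply: polyfunD; first exact: polyfun_cst.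
  by apply: polyfun_lin => a x y; rewrite hl ll.
by apply/funext => w /=; rewrite -[v0]scale1r ll scale1r mul1r.
Qed.

Lemma polyfun_line f u v :
  polyfun f -> exists p : {poly K}, forall s, f (u + s *: v) = p.[s].
Proof.
elim=> [c|l ll|{}f g _ [p fp] _ [q gq]|{}f g _ [p fp] _ [q gq]].
- by exists c%:P => s; rewrite hornerC.
- exists ((l u)%:P + (l v) *: 'X) => s.
  by rewrite hornerD hornerZ hornerX hornerC addrC ll addrC mulrC.
- by exists (p + q) => s; rewrite hornerD fp gq.
- by exists (p * q) => s; rewrite hornerM fp gq.
Qed.

(** On the line through [u] and [v] both functions restrict to nonzero polynomials in one variable,
    whose product has a nonroot. Hence finite unions of thin sets are thin. *)
Lemma polyfun_common_nonroot f g u v : polyfun f -> polyfun g ->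
  f u != 0 -> g v != 0 -> exists w, f w != 0 /\ g w != 0.
Proof.
move=> /(@polyfun_line _ u (v - u))[p fp] /(@polyfun_line _ u (v - u))[q gq] fu gv.
have p0 : p != 0.
  by apply: contraNneq fu => p0; rewrite -[u]addr0 -(scale0r (v - u)) fp p0 horner0.
have q0 : q != 0.
  apply: contraNneq gv => q0.
  by have := gq 1; rewrite scale1r addrC subrK => ->; rewrite q0 horner0.
have [s] := poly_nonroot (mulf_neq0 p0 q0).
rewrite hornerM mulf_eq0 negb_or -fp -gq => /andP[? ?].
by exists (u + s *: (v - u)).
Qed.

End Closure.

Lemma scalar_coord (V : vectType K) (l : V -> K) v : scalar l ->
  l v = \sum_k v2r v 0 k * l (r2v (delta_mx 0 k)).
Proof.
move=> ll; pose L : {scalar V} := HB.pack l (GRing.isLinear.Build K V K _ l ll).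
rewrite -[l]/(L : V -> K) -[in LHS](v2rK v) [X in r2v X]row_sum_delta !linear_sum.
by apply: eq_bigr => k _; rewrite 2!linearZ.
Qed.

(** [idx] places the coordinates of [V] among possibly more variables, because elimination adjoins
    variables to those of the parameter space. *)
Lemma polyfun_mpoly (V : vectType K) (f : V -> K) m (idx : 'I_(dim V) -> 'I_m) :
  polyfun f -> exists P : mpoly m K, forall (v : V) (s : 'I_m -> K),
    (forall k, s (idx k) = v2r v 0 k) -> f v = meval s P.
Proof.
elim=> [c|l ll|{}f g _ [p fp] _ [q gq]|{}f g _ [p fp] _ [q gq]].
- by exists (mpolyC m c) => v s _; rewrite mevalC.
- pose e k : V := r2v (delta_mx 0 k).
  exists (\sum_k l (e k) *: mpolyX K (mnm1 (idx k))) => v s hs.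
  rewrite raddf_sum /=.
  under eq_bigr do rewrite mevalZ mevalXU hs mulrC.
  exact: scalar_coord.
- by exists (p + q) => v s hs; rewrite mevalD (fp _ _ hs) (gq _ _ hs).
- by exists (p * q) => v s hs; rewrite mevalM (fp _ _ hs) (gq _ _ hs).
Qed.

Definition thin (V : lmodType K) (B : set V) :=
  exists f, [/\ polyfun f, exists v, f v != 0 & forall v, B v -> f v = 0].

Lemma thinS (V : lmodType K) (A B : set V) : A `<=` B -> thin B -> thin A.
Proof. by move=> AB [f [pf f0 fB]]; exists f; split=> // v /AB/fB. Qed.

Lemma thin0 (V : lmodType K) : thin (@set0 V).
Proof.
exists (fun=> 1); split=> [||v []]; first exact: polyfun_cst.
by exists 0; rewrite oner_neq0.
Qed.

Lemma thinU (V : lmodType K) (A B : set V) : thin A -> thin B -> thin (A `|` B).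
Proof.
move=> [f [pf [u fu] fA]] [g [pg [v gv] gB]].
have [w [fw gw]] := polyfun_common_nonroot pf pg fu gv.
exists (fun v => f v * g v); split; first exact: polyfunM.
  by exists w; rewrite mulf_neq0.
by move=> x [/fA->|/gB->]; rewrite ?mul0r ?mulr0.
Qed.

Lemma thin_bigcup (V : lmodType K) (I : finType) (B : I -> set V) :
  (forall i, thin (B i)) -> thin [set v | exists i, B i v].
Proof.
move=> tB; suff H (s : seq I) : thin [set v | exists2 i, i \in s & B i v].
  by apply: thinS (H (enum I)) => v [i Bi]; exists i => //; rewrite mem_enum.
elim: s => [|i s IH]; first by apply: thinS (thin0 V) => v [].
apply: thinS (thinU (tB i) IH) => v [j]; rewrite inE => /predU1P[->|js] Bj.
  by left.
by right; exists j.
Qed.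

End PolynomialFunctions.

(** * Elimination of parameters from linear conditions *)

Section Incidence.
Variable K : numFieldType.

(** Kronecker substitution: replacing the k-th variable by [x ^+ (D ^ k)] sends distinct monomials
    with exponents below [D] to distinct powers of [x], so a nonzero polynomial in one variable
    remains. *)
Lemma monomial_comb_nonroot N D (c : {ffun 'I_N -> 'I_D} -> K) :
  (exists a, c a != 0) ->
  exists y : 'I_N -> K, \sum_a c a * \prod_k y k ^+ a k != 0.
Proof.
move=> [a0 ca0].
pose wt (a : {ffun 'I_N -> 'I_D}) := (\sum_k a k * D ^ k)%N.
have wtI : injective wt.
  move=> a b E; apply/ffunP => k; apply/val_inj.
  exact: (digits_inj (a := fun k => a k) (b := fun k => b k)).
pose p : {poly K} := \sum_a c a *: 'X^(wt a).
have p0 : p != 0.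
  apply: contraNneq ca0 => /(congr1 (fun p : {poly K} => p`_(wt a0))).
  rewrite coef0 coef_sum (bigD1 a0)//= coefZ coefXn eqxx mulr1 big1 ?addr0.
    by move=> ->.
  by move=> b ba0; rewrite coefZ coefXn eq_sym (inj_eq wtI) (negPf ba0) mulr0.
have [x px] := poly_nonroot p0; exists (fun k => x ^+ (D ^ k)).
apply: contraNneq px => px; rewrite horner_sum -[X in _ == X]px; apply/eqP.
apply: eq_bigr => a _; rewrite hornerZ hornerXn; congr (_ * _).
by rewrite -prodrXr; apply: eq_bigr => k _; rewrite -exprM mulnC.
Qed.

(** The left kernel of [A] has dimension [e]; a basis of it has [e] independent columns, and a
    kernel vector is determined by its coordinates there. *)
Lemma row_full_completion N d e (A : 'M[K]_(N, d)) : row_full A -> (N = d + e)%N ->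
  exists kap : {ffun 'I_e -> 'I_N}, forall v : 'rV[K]_N,
    v *m A = 0 -> (forall j, v 0 (kap j) = 0) -> v = 0.
Proof.
move=> Afull Nde.
have rk : \rank (kermx A) = e.
  by rewrite mxrank_ker (eqP Afull) Nde addKn.
have [W [Wfree WE]] : exists W : 'M[K]_(e, N), row_free W /\ (kermx A <= W)%MS.
  by case: _ / rk; exists (row_base (kermx A)); rewrite row_base_free eq_row_base.
have Wfull : row_full W^T by rewrite /row_full mxrank_tr.
exists [ffun j => fullrankfun Wfull j] => v vA vk.
have /submxP[c vE] : (v <= W)%MS by rewrite (submx_trans _ WE)//; exact/sub_kermxP.
have U := fullrowsub_unit Wfull.
suff c0 : c = 0 by rewrite vE c0 mul0mx.
have : c *m (rowsub (fullrankfun Wfull) W^T)^T = 0.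
  apply/rowP => j; have := vk j; rewrite ffunE vE !mxE => E.
  by rewrite -[RHS]E; apply: eq_bigr => k _; rewrite !mxE.
by move/(canRL (mulmxK _)) => ->; rewrite ?unitmx_tr// mul0mx.
Qed.

Variables T V : vectType K.
Variables (D : finType) (L : D -> T -> V -> K) (w : D -> T -> K).

(* The expected codimension [#|D|] of the fibres exceeds the dimension of the
   parameter space.  Completing the rows [L d t] by coordinate rows, Cramer's
   rule expresses the solutions rationally in terms of fewer than [dim V]
   parameters. *)
Lemma thin_incidence :
  (forall d t, scalar (L d t)) -> (forall d v, polyfun (fun t => L d t v)) ->
  (forall d, polyfun (w d)) -> (dim T < #|D|)%N ->
  thin [set v | exists t, (forall u : D -> K, exists v', forall d, L d t v' = u d)
                          /\ forall d, L d t v = w d t].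
Proof.
move=> Llin Lpoly wpoly TD; set N := dim V; set M := dim T.
pose b k : V := r2v (delta_mx 0 k).
have LE d t v : L d t v = \sum_k v2r v 0 k * L d t (b k).
  exact: scalar_coord.
pose A t : 'M[K]_(N, #|D|) := \matrix_(k, d) L (enum_val d) t (b k).
have vA (v : V) t d : (v2r v *m A t) 0 d = L (enum_val d) t v.
  by rewrite LE mxE; apply: eq_bigr => k _; rewrite !mxE.
have Afull t : (forall u : D -> K, exists v', forall d, L d t v' = u d) ->
    row_full (A t).
  move=> surj; have [B HB] := choice (fun i : 'I_#|D| => surj (fun d => (d == enum_val i)%:R)).
  apply/row_fullP; exists (\matrix_i v2r (B i)); apply/row_matrixP => i.
  rewrite row_mul rowK; apply/rowP => d; rewrite vA HB !mxE.
  by rewrite (inj_eq enum_val_inj) eq_sym.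
(* More than [dim V] conditions are never independent, and the set is then empty. *)
have [DN|ND] := leqP #|D| N; last first.
  apply: thinS (thin0 V) => v [t [/Afull + _]].
  by rewrite /row_full => /eqP E; have := rank_leq_row (A t); rewrite E leqNgt ND.
pose e := (N - #|D|)%N.
have NE : N = (#|D| + e)%N by rewrite subnKC.
have cardE : N = #|{: D + 'I_e}| by rewrite card_sum card_ord.
pose phi (i : 'I_N) : D + 'I_e := enum_val (cast_ord cardE i).
pose phi' (x : D + 'I_e) : 'I_N := cast_ord (esym cardE) (enum_rank x).
have phiK x : phi (phi' x) = x by rewrite /phi /phi' cast_ordKV enum_rankK.
(* The first [M] variables are the coordinates of [t]; the last [e] stand for the coordinates of [v]
   that complete the conditions to a square system. *)
pose idx : 'I_M -> 'I_(M + e) := lshift e.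
have [P PP] := choice (fun dk : D * 'I_N => @polyfun_mpoly K T _ _ idx (Lpoly dk.1 (b dk.2))).
have [Q QQ] := choice (fun d => @polyfun_mpoly K T _ _ idx (wpoly d)).
pose X j : mpoly (M + e) K := mpolyX K (mnm1 (rshift M j)).
pose B (kap : {ffun 'I_e -> 'I_N}) : 'M[mpoly (M + e) K]_N :=
  \matrix_(i, k) match phi i with inl d => P (d, k) | inr j => (k == kap j)%:R end.
pose rhs : 'cV[mpoly (M + e) K]_N :=
  \col_i match phi i with inl d => Q d | inr j => X j end.
have MeN : (M + e < N)%N by rewrite NE ltn_add2r.
(* The completing coordinates [kap] depend on [t], but range over a finite type, so each choice can
   be treated separately. *)
pose Bad (kap : {ffun 'I_e -> 'I_N}) : set V := [set v | exists t : T, (forall v' : 'rV[K]_N,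
    v' *m A t = 0 -> (forall j, v' 0 (kap j) = 0) -> v' = 0) /\
    forall d, L d t v = w d t].
have : thin [set v | exists kap, Bad kap v].
  apply: thin_bigcup => kap.
  (* By Cramer's rule, [\det (B kap)] times a coordinate of [v] is the corresponding entry of
     [\adj (B kap) *m rhs]. These are polynomials in [M + e < N] variables, so the [N] coordinates
     of [v] satisfy a fixed relation. *)
  have [D' [c [c0 cP]]] := algebraic_dependence
    (fun k => (\adj (B kap) *m rhs) k 0) (\det (B kap)) MeN.
  exists (fun v : V => \sum_a c a * \prod_k v2r v 0 k ^+ a k); split.
  - apply: polyfun_sum => a; apply: polyfunM; first exact: polyfun_cst.
    apply: polyfun_prod => k; apply: polyfunX; apply: polyfun_lin => x u v.
    by rewrite linearP !mxE.
  - have [y y0] := monomial_comb_nonroot c0; exists (@r2v K V (\row_k y k)).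
    apply: contraNneq y0 => E; rewrite -[X in _ == X]E r2vK; apply/eqP.
    by apply: eq_bigr => a _; congr (_ * _); apply: eq_bigr => k _; rewrite mxE.
  - move=> v [t [inj_t vt]].
    pose s (i : 'I_(M + e)) := match fintype.split i with
      inl k => v2r t 0 k | inr j => v2r v 0 (kap j) end.
    have sl k : s (idx k) = v2r t 0 k by rewrite /s /idx (unsplitK (inl k)).
    have sr j : s (rshift M j) = v2r v 0 (kap j) by rewrite /s (unsplitK (inr j)).
    pose Bs := map_mx (meval s) (B kap).
    have BsE (u : 'rV[K]_(dim V)) i : (Bs *m u^T) i 0 =
        match phi i with inl d => L d t (@r2v K V u) | inr j => u 0 (kap j) end.
      rewrite mxE; case phiE: (phi i) => [d|j].
        rewrite LE r2vK; apply: eq_bigr => k _; rewrite !mxE phiE mulrC; congr (_ * _).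
        by rewrite -(PP (d, k) t s).
      rewrite (bigD1 (kap j))//= !mxE phiE eqxx meval1 mul1r big1 ?addr0// => k kj.
      by rewrite !mxE phiE (negPf kj) meval0 mul0r.
    apply: (cP s).
      suff : Bs^T \in unitmx by rewrite unitmxE det_tr det_map_mx unitfE.
      rewrite -row_free_unit.
      rewrite -kermx_eq0; apply/rowV0P => u /sub_kermxP uB.
      have {}uB : Bs *m u^T = 0 by rewrite -[LHS]trmxK trmx_mul trmxK uB trmx0.
      apply: inj_t => [|j].
        apply/rowP => d; have := BsE u (phi' (inl (enum_val d))).
        by rewrite uB phiK mxE -vA r2vK => <-; rewrite mxE.
      by have := BsE u (phi' (inr j)); rewrite uB phiK mxE => <-.
    have BE : Bs *m (v2r v)^T = map_mx (meval s) rhs.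
      apply/colP => i; rewrite BsE v2rK !mxE.
      case: (phi i) => [d|j]; first by rewrite vt (QQ d t s).
      by rewrite mevalXU sr.
    move=> k; have := congr1 (mulmx (\adj Bs)) BE.
    rewrite mulmxA mul_adj_mx mul_scalar_mx -map_mx_adj -map_mxM det_map_mx.
    by move=> /colP /(_ k); rewrite !mxE.
apply: thinS => v [t [/Afull surj vt]].
have [kap kapP] := row_full_completion surj NE.
by exists kap, t.
Qed.

End Incidence.

Local Notation homog d := (@ishomog1 _ _ d mdeg).

(** * Interpolation of jets *)

(* Locked, because the unfolding of [ev] is a big sum, which the rewriting rules
   for sums would match. *)
HB.lock Definition ev (K : numFieldType) n (P : mpoly n K) (x : 'rV[K]_n) : K :=
  meval (fun j => x 0 j) P.

(* [pd i k P] is the derivative of [P] in the k-th coordinate of the chart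
   [x_i = 1]. *)
HB.lock Definition pd (K : numFieldType) n (i : 'I_n.+1) (k : 'I_n)
    (P : mpoly n.+1 K) : mpoly n.+1 K := mderiv (lift i k) P.

Section Jets.
Variables (K : numFieldType) (n : nat).
Implicit Types (P Q : mpoly n.+1 K) (x y : 'rV[K]_n.+1) (i j : 'I_n.+1).

Definition lform (c : 'I_n.+1 -> K) : mpoly n.+1 K :=
  \sum_j c j *: mpolyX K (mnm1 j).

Lemma ev_meval P x : ev P x = meval (fun j => x 0 j) P.
Proof. by rewrite ev.unlock. Qed.

Lemma pd_mderiv i k P : pd i k P = mderiv (lift i k) P.
Proof. by rewrite pd.unlock. Qed.

Lemma evE P x : ev P x = \sum_(m <- msupp P) mcoeff m P * \prod_j x 0 j ^+ m j.
Proof. by rewrite !ev_meval; exact: mevalE. Qed.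
Lemma evD P Q x : ev (P + Q) x = ev P x + ev Q x.
Proof. by rewrite !ev_meval; exact: mevalD. Qed.
Lemma evB P Q x : ev (P - Q) x = ev P x - ev Q x.
Proof. by rewrite !ev_meval; exact: mevalB. Qed.
Lemma evM P Q x : ev (P * Q) x = ev P x * ev Q x.
Proof. by rewrite !ev_meval; exact: mevalM. Qed.
Lemma evZ c P x : ev (c *: P) x = c * ev P x.
Proof. by rewrite !ev_meval; exact: mevalZ. Qed.
Lemma evX P x k : ev (P ^+ k) x = ev P x ^+ k.
Proof. by rewrite !ev_meval rmorphXn. Qed.
Lemma evC c x : ev (mpolyC _ c) x = c. Proof. by rewrite !ev_meval; exact: mevalC. Qed.

Lemma ev_sum (I : Type) (r : seq I) (A : pred I) (F : I -> mpoly n.+1 K) x :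
  ev (\sum_(k <- r | A k) F k) x = \sum_(k <- r | A k) ev (F k) x.
Proof. by rewrite ev_meval raddf_sum; apply: eq_bigr => k _; rewrite ev_meval. Qed.

Lemma pdD i k P Q : pd i k (P + Q) = pd i k P + pd i k Q.
Proof. by rewrite !pd_mderiv mderivD. Qed.
Lemma pdZ i k c P : pd i k (c *: P) = c *: pd i k P.
Proof. by rewrite !pd_mderiv mderivZ. Qed.
Lemma pd_sum (I : Type) (r : seq I) (A : pred I) i l (F : I -> mpoly n.+1 K) :
  pd i l (\sum_(k <- r | A k) F k) = \sum_(k <- r | A k) pd i l (F k).
Proof. by rewrite pd_mderiv raddf_sum; apply: eq_bigr => k _; rewrite pd_mderiv. Qed.
Lemma pd_comm i k l P : pd i k (pd i l P) = pd i l (pd i k P).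
Proof. by rewrite !pd_mderiv mderiv_comm. Qed.
Lemma pdM i k P Q : pd i k (P * Q) = pd i k P * Q + P * pd i k Q.
Proof. by rewrite !pd_mderiv mderivM. Qed.

Lemma ev_lform c x : ev (lform c) x = \sum_j c j * x 0 j.
Proof.
rewrite ev_sum; apply: eq_bigr => j _.
by rewrite evZ ev_meval mevalXU.
Qed.

Lemma mderiv_lform c j : mderiv j (lform c) = mpolyC _ (c j).
Proof.
rewrite /lform raddf_sum /= (bigD1 j)//= big1 ?addr0 => [|k kj].
  rewrite mderivZ mderivX mnm1E eqxx scale1r.
  rewrite (_ : mnm_sub _ _ = mnm0) ?mpolyX0 -?alg_mpolyC//.
  by apply/mnmP => k; rewrite mnmBE mnm0E subnn.
by rewrite mderivZ mderivX mnm1E (negPf kj) scale0r scaler0.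
Qed.

Lemma pd_lform i k c : pd i k (lform c) = mpolyC _ (c (lift i k)).
Proof. by rewrite pd_mderiv mderiv_lform. Qed.

Lemma homog_lform c : lform c \is homog 1.
Proof. by apply: rpred_sum => j _; apply: rpredZ; rewrite dhomogX /= mdeg1. Qed.

Lemma homog_mderiv d P j : P \is homog d -> mderiv j P \is homog d.-1.
Proof.
move=> /dhomogP hP; rewrite [P]mpolyE raddf_sum /= big_seq.
apply: rpred_sum => m /hP md; rewrite linearZ rpredZ//= mderivX.
have [->|mj] := eqVneq (m j) 0%N; first by rewrite scale0r rpred0.
rewrite rpredZ// dhomogX; apply/eqP.
have mK : mnm_add (mnm_sub m (mnm1 j)) (mnm1 j) = m by rewrite submK// lep1mP.
by rewrite -(md : mdeg m = d) -[in RHS]mK mdegD mdeg1 addn1.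
Qed.

(** On a monomial, deriving in a variable and multiplying by it again yields the exponent as a
    factor, and the exponents add up to [d]. *)
Lemma euler_identity d P x : P \is homog d ->
  \sum_j x 0 j * ev (mderiv j P) x = d%:R * ev P x.
Proof.
move=> /dhomogP hP; under eq_bigr do rewrite ev_meval.
rewrite ev_meval.
have dE j : mderiv j P = \sum_(m <- msupp P) mcoeff m P *: mderiv j (mpolyX K m).
  by rewrite [in LHS](mpolyE P) linear_sum; apply: eq_bigr => m _; rewrite linearZ.
under eq_bigr do rewrite dE raddf_sum mulr_sumr.
rewrite [in RHS](mpolyE P) raddf_sum /=.
rewrite exchange_big mulr_sumr /=; apply: eq_big_seq => m /hP md.
rewrite -(md : mdeg m = d) mdegE natr_sum mulr_suml; apply: eq_bigr => j _.
rewrite mderivX !mevalZ mulrCA [RHS]mulrCA; congr (_ * _).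
have [->|mj] := eqVneq (m j) 0%N; first by rewrite !mul0r mulr0.
rewrite mulrCA; congr (_ * _).
have mK : mnm_add (mnm_sub m (mnm1 j)) (mnm1 j) = m by rewrite submK// lep1mP.
by rewrite -[in RHS]mK mpolyXD mevalM mevalXU mulrC.
Qed.

Lemma ev_homogZ d P c x : P \is homog d -> ev P (c *: x) = c ^+ d * ev P x.
Proof.
move=> /dhomogP hP; rewrite !evE mulr_sumr.
apply: eq_big_seq => m /hP md; rewrite -(md : mdeg m = d).
rewrite mulrCA; congr (_ * _).
under eq_bigr do rewrite mxE exprMn.
by rewrite big_split /= prodrXr -mdegE.
Qed.

Lemma ev_homog_affine d P s x y : P \is homog d -> (d <= 1)%N ->
  ev P ((1 - s) *: x + s *: y) = (1 - s) * ev P x + s * ev P y.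
Proof.
move=> /dhomogP hP d1; rewrite (mpolyE P) !ev_meval !raddf_sum /= !mulr_sumr -big_split /=.
apply: eq_big_seq => m /hP md; rewrite !mevalZ.
rewrite mulrCA [s * _]mulrCA -mulrDr; congr (_ * _).
move: d1; rewrite -(md : mdeg m = d) leq_eqVlt ltnS leqn0 => /orP[/mdeg1P[j /eqP ->]|].
  by rewrite !mevalXU !mxE.
by rewrite mdeg_eq0 => /eqP ->; rewrite mpolyX0 !meval1 !mulr1 subrK.
Qed.

Section OnePoint.
Variables (i : 'I_n.+1) (x : 'rV[K]_n.+1).
Hypothesis xi : x 0 i = 1.

Let Xi : mpoly n.+1 K := mpolyX K (mnm1 i).

(* The equation of the hyperplane through [x] parallel, in the chart
   [x_i = 1], to the k-th coordinate hyperplane. *)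
Let Y (k : 'I_n) : mpoly n.+1 K :=
  lform (fun j => (j == lift i k)%:R - x 0 (lift i k) * (j == i)%:R).

Let pdXi m k : pd i k (Xi ^+ m) = 0.
Proof.
have pd1 : pd i k Xi = 0.
  rewrite pd_mderiv mderivX mnm1E.
  by rewrite -(inj_eq val_inj)/= eq_sym -[bump _ _]/(val (lift i k)) (inj_eq val_inj)
     eq_sym (negPf (neq_lift _ _)) scale0r.
elim: m => [|m IH]; first by rewrite expr0 pd_mderiv -mpolyC1 mderivC.
by rewrite exprS pdM IH pd1 mul0r mulr0 addr0.
Qed.

Let evXi m : ev (Xi ^+ m) x = 1.
Proof. by rewrite evX ev_meval mevalXU xi expr1n. Qed.

Let homogXi m : Xi ^+ m \is homog m.
Proof.
by rewrite -[X in ishomog1 X]mul1n; apply: dhomogMn; rewrite dhomogX /= mdeg1.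
Qed.

Let evY k : ev (Y k) x = 0.
Proof.
rewrite ev_lform (bigD1 (lift i k))//= (bigD1 i)/= ?neq_lift//.
rewrite big1 ?addr0 => [|j /andP[j1 j2]].
  rewrite !eqxx xi [lift _ _ == i]eq_sym !(negPf (neq_lift _ _)) /=.
  by ring.
by rewrite (negPf j1) (negPf j2) mulr0 subr0 mul0r.
Qed.

Let pdY k l : pd i l (Y k) = mpolyC _ (k == l)%:R.
Proof.
rewrite pd_lform (inj_eq lift_inj) [lift _ _ == i]eq_sym (negPf (neq_lift _ _)).
by rewrite mulr0 subr0 eq_sym.
Qed.

(** In the chart [Xi] is the constant 1, so a power of [Xi] times the linear form [L] reads as an
    affine function with the given value and gradient. *)
Lemma jet1_interpolation a al (df : 'I_n -> K) : (0 < a)%N ->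
  exists2 P, P \is homog a & [/\ ev P x = al,
    forall k, ev (pd i k P) x = df k & forall k l, ev (pd i k (pd i l P)) x = 0].
Proof.
case: a => // a _; pose L := al *: Xi + \sum_k df k *: Y k.
have evS (c : 'I_n -> K) : ev (\sum_k c k *: Y k) x = 0.
  by rewrite ev_sum big1// => k _; rewrite evZ evY mulr0.
have pdL l : pd i l L = mpolyC _ (df l).
  rewrite /L pdD pdZ -[Xi]expr1 pdXi scaler0 add0r pd_sum (bigD1 l)//=.
  rewrite pdZ pdY eqxx mpolyC1 big1 ?addr0 ?alg_mpolyC// => k kl.
  by rewrite pdZ pdY (negPf kl) mpolyC0 scaler0.
exists (Xi ^+ a * L).
  rewrite -(addn1 a); apply: dhomogM => //; apply: rpredD.
    by apply: rpredZ; rewrite dhomogX /= mdeg1.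
  by apply: rpred_sum => k _; apply: rpredZ; exact: homog_lform.
split=> [|k|k l].
- by rewrite evM evXi mul1r /L evD evZ evS addr0 -[Xi]expr1 evXi mulr1.
- by rewrite pdM pdXi mul0r add0r pdL evM evXi evC mul1r.
- rewrite pdM pdXi mul0r add0r pdL pdM pdXi mul0r add0r pd_mderiv mderivC mulr0.
  by rewrite ev_meval meval0.
Qed.

(* The second derivative of [Y j * R] at [x], with [R] a combination of the
   [Y k], is [e_j * r^T + r * e_j^T]. *)
Lemma jet2_interpolation a al (df r v : 'I_n -> K) (j : 'I_n) : (1 < a)%N -> v j = 1 ->
  exists2 P, P \is homog a & [/\ ev P x = al,
    forall k, ev (pd i k P) x = df k &
    forall k, \sum_l v l * ev (pd i k (pd i l P)) x = r k].
Proof.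
move=> a1 vj.
have [P hP [P0 P1 P2]] := jet1_interpolation al df (ltnW a1).
case: a a1 P hP P0 P1 P2 => [|[|a]]// _ P hP P0 P1 P2.
(* Contracting the second derivatives of [Y j * S] with [v] gives [r' k], plus [\sum_l v l * r' l]
   when [k = j]. As [v j = 1], that sum is [t - t / 2], which restores what [r'] subtracts. *)
pose t := \sum_l v l * r l.
pose r' k := r k - t / 2 * (k == j)%:R.
pose S := \sum_k r' k *: Y k.
have evS : ev S x = 0.
  by rewrite ev_sum big1// => k _; rewrite evZ evY mulr0.
have pdS l : pd i l S = mpolyC _ (r' l).
  rewrite pd_sum (bigD1 l)//=.
  rewrite pdZ pdY eqxx mpolyC1 big1 ?addr0 ?alg_mpolyC// => k kl.
  by rewrite pdZ pdY (negPf kl) mpolyC0 scaler0.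
pose Q := Xi ^+ a * (Y j * S).
have Q1 l : pd i l Q = Xi ^+ a * ((j == l)%:R *: S + r' l *: Y j).
  rewrite /Q !pdM pdXi mul0r add0r pdY pdS mul_mpolyC.
  by rewrite [Y j * _]mulrC mul_mpolyC.
have Q2 k l : ev (pd i k (pd i l Q)) x = (j == l)%:R * r' k + r' l * (j == k)%:R.
  rewrite Q1 pdM pdXi mul0r add0r pdD !pdZ pdY pdS evM evXi mul1r.
  by rewrite evD !evZ !evC.
exists (P + Q).
  apply: rpredD => //; rewrite /Q -(addn2 a); apply: dhomogM => //.
  apply: (@dhomogM _ _ _ 1 _ 1); first exact: homog_lform.
  by apply: rpred_sum => k _; apply: rpredZ; exact: homog_lform.
split=> [|k|k].
- by rewrite evD P0 /Q !evM evS !mulr0 addr0.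
- rewrite pdD evD P1 Q1 evM evD !evZ evS evY !mulr0 addr0 mulr0.
  by rewrite addr0.
- under eq_bigr => l _.
    rewrite !pdD evD P2 add0r Q2 mulrDr mulrCA.
    over.
  rewrite big_split /= (bigD1 j)//= eqxx vj !mul1r [X in _ + X + _]big1 ?addr0; last first.
    by move=> l lj; rewrite eq_sym (negPf lj) mul0r.
  rewrite -[X in _ + X](@eq_bigr _ _ _ _ _ _ (fun l => (v l * r' l) * (j == k)%:R)); last first.
    by move=> l _; rewrite mulrA.
  rewrite -mulr_suml.
  have -> : \sum_l v l * r' l = t / 2.
    under eq_bigr do rewrite mulrBr.
    rewrite big_split /= sumrN -/t (bigD1 j)//= eqxx vj big1 => [|l lj].
      by rewrite /=; field.
    by rewrite (negPf lj) !mulr0.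
  by rewrite /r' [k == j]eq_sym; ring.
Qed.

End OnePoint.

Section TwoPoints.
Variables (x y : 'rV[K]_n.+1).

(** Linear independence through a nonzero 2x2 minor; for nonzero vectors, distinctness in projective
    space. *)
Definition independent_points := exists j k, x 0 j * y 0 k != x 0 k * y 0 j.

(** The form is the 2x2 minor against [y], divided by its value at [x]. *)
Lemma separating_lform : independent_points ->
  exists c, ev (lform c) x = 1 /\ ev (lform c) y = 0.
Proof.
move=> [j [k jk]]; pose D := x 0 j * y 0 k - x 0 k * y 0 j.
have D0 : D != 0 by rewrite subr_eq0.
have kj : j != k by apply: contraNneq jk => ->.
exists (fun l => D^-1 * (y 0 k * (l == j)%:R - y 0 j * (l == k)%:R)).
have E z : ev (lform (fun l => D^-1 * (y 0 k * (l == j)%:R - y 0 j * (l == k)%:R))) z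
    = D^-1 * (y 0 k * z 0 j - y 0 j * z 0 k).
  rewrite ev_lform (bigD1 j)//= (bigD1 k) 1?eq_sym//= big1 ?addr0.
    by rewrite !eqxx [k == j]eq_sym (negPf kj) /=; ring.
  by move=> l /andP[/negPf -> /negPf ->]; rewrite !mulr0 subr0 mulr0 mul0r.
rewrite !E; split; last by ring.
by rewrite -(mulVf D0); congr (_ * _); rewrite /D; ring.
Qed.

End TwoPoints.

Lemma independent_points_sym x y : independent_points x y -> independent_points y x.
Proof. by move=> [j [k jk]]; exists k, j; rewrite ![y 0 _ * _]mulrC. Qed.

Lemma value_interpolation a x y al be : (0 < a)%N -> independent_points x y ->
  exists2 P, P \is homog a & ev P x = al /\ ev P y = be.
Proof.
move=> a0 xy; have [c [cx cy]] := separating_lform xy.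
have [d [dy dx]] := separating_lform (independent_points_sym xy).
exists (al *: lform c ^+ a + be *: lform d ^+ a).
  have H e : lform e ^+ a \is homog a.
    by have := dhomogMn a (homog_lform e); rewrite mul1n.
  by apply: rpredD; apply: rpredZ; exact: H.
rewrite !evD !evZ !evX cx cy dx dy expr1n expr0n eqn0Ngt a0.
by rewrite !mulr0 !mulr1 addr0 add0r.
Qed.

(** The square of a linear form that is 1 at one point and 0 at the other kills the 1-jet at the
    latter, which decouples the two points at the cost of degree 2. The terms [2 * al * c] and
    [2 * be * d] compensate the derivatives of the squares. *)
Lemma jet1_interpolation2 a i i' x y al be (df dg : 'I_n -> K) : (2 < a)%N ->
  x 0 i = 1 -> y 0 i' = 1 -> independent_points x y ->
  exists2 P, P \is homog a & [/\ ev P x = al, ev P y = be,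
    forall k, ev (pd i k P) x = df k & forall k, ev (pd i' k P) y = dg k].
Proof.
case: a => [|[|a]]// a0 xi yi xy; have [c [cx cy]] := separating_lform xy.
have [d [dy dx]] := separating_lform (independent_points_sym xy).
have a0' : (0 < a)%N by [].
have [P hP [P0 P1 _]] := jet1_interpolation xi al
  (fun k => df k - 2 * al * c (lift i k)) a0'.
have [Q hQ [Q0 Q1 _]] := jet1_interpolation yi be
  (fun k => dg k - 2 * be * d (lift i' k)) a0'.
exists (lform c ^+ 2 * P + lform d ^+ 2 * Q).
  by apply: rpredD; rewrite -(add2n a); apply: dhomogM => //;
    apply: (@dhomogMn _ _ _ 1 _ 2); exact: homog_lform.
split=> [||k|k].
- by rewrite evD !evM cx dx P0; ring.
- by rewrite evD !evM cy dy Q0; ring.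
- rewrite pdD !expr2 !pdM !pd_lform !(evD, evM) !evC cx dx P0 P1; ring.
- rewrite pdD !expr2 !pdM !pd_lform !(evD, evM) !evC cy dy Q0 Q1; ring.
Qed.

End Jets.

(** * Degeneracy loci *)

Section ScalarFunctions.
Variables (K : numFieldType) (V : lmodType K).
Implicit Types f g : V -> K.

Lemma scalarD f g : scalar f -> scalar g -> scalar (fun v => f v + g v).
Proof. by move=> hf hg c u v; rewrite hf hg; ring. Qed.

Lemma scalarB f g : scalar f -> scalar g -> scalar (fun v => f v - g v).
Proof. by move=> hf hg c u v; rewrite hf hg; ring. Qed.

Lemma scalar_mull c f : scalar f -> scalar (fun v => c * f v).
Proof. by move=> hf d u v; rewrite hf; ring. Qed.

Lemma scalar_sum (I : Type) (s : seq I) (f : I -> V -> K) :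
  (forall i, scalar (f i)) -> scalar (fun v => \sum_(i <- s) f i v).
Proof.
by move=> hf c u v; rewrite mulr_sumr -big_split; apply: eq_bigr => i _; exact: hf.
Qed.

Lemma thin_preimage (W : lmodType K) (h : W -> V) (B : set V) :
  linear h -> (forall v, exists w, h w = v) -> thin B -> thin (h @^-1` B).
Proof.
move=> hl hs [f [pf [v fv] fB]]; exists (f \o h); split=> [||w /fB//].
  by apply: polyfun_comp pf => l ll; apply: polyfun_lin => c u w /=; rewrite hl ll.
by have [w hw] := hs v; exists w; rewrite /= hw.
Qed.

End ScalarFunctions.

Lemma dim_row (K : numFieldType) m : dim 'rV[K]_m = m.
Proof. exact: mul1n. Qed.

Lemma dim_pair (K : numFieldType) (U W : vectType K) :
  dim (U * W)%type = (dim U + dim W)%N.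
Proof. by []. Qed.

Lemma dim_regular (K : numFieldType) : dim K^o = 1%N.
Proof. by []. Qed.

Section DegeneracyLoci.
Variables (K : numFieldType) (n a b p q : nat).
Local Notation PA := (dhomog n.+1 K a).
Local Notation PB := (dhomog n.+1 K b).
Hypotheses (a0 : (0 < a)%N) (b0 : (0 < b)%N) (p0 : (0 < p)%N) (q0 : (0 < q)%N).
Implicit Types (i : 'I_n.+1) (z : 'rV[K]_n).

Let pK : p%:R != 0 :> K. Proof. by rewrite pnatr_eq0 -lt0n. Qed.
Let qK : q%:R != 0 :> K. Proof. by rewrite pnatr_eq0 -lt0n. Qed.

(* [chart_vec], to which it is convertible, over an arbitrary field. *)
Definition chart_pt i z : 'rV[K]_n.+1 :=
  \row_j if unlift i j is Some k then z 0 k else 1.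

Lemma chart_pt_i i z : chart_pt i z 0 i = 1.
Proof. by rewrite mxE unlift_none. Qed.

Lemma chart_pt_lift i z k : chart_pt i z 0 (lift i k) = z 0 k.
Proof. by rewrite mxE liftK. Qed.

Lemma scalar_ev d x : scalar (fun F : dhomog n.+1 K d => ev F x).
Proof. by move=> c u v; rewrite linearP evD evZ. Qed.

Lemma scalar_pd d x i k : scalar (fun F : dhomog n.+1 K d => ev (pd i k F) x).
Proof. by move=> c u v; rewrite linearP pdD pdZ evD evZ. Qed.

Lemma scalar_pd2 d x i k l :
  scalar (fun F : dhomog n.+1 K d => ev (pd i k (pd i l F)) x).
Proof. by move=> c u v; rewrite linearP !pdD !pdZ evD evZ. Qed.

Lemma scalar_coef (m : nat) k : scalar (fun z : 'rV[K]_m => z 0 k).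
Proof. by move=> c u v; rewrite !mxE. Qed.

Lemma scalar_id : scalar (fun s : K^o => s : K).
Proof. by []. Qed.

Lemma polyfun_ev_comp (T : lmodType K) (x : T -> 'rV[K]_n.+1) P :
  (forall j, polyfun (fun t => x t 0 j)) -> polyfun (fun t => ev P (x t)).
Proof.
move=> hx; rewrite (_ : (fun _ => _) = fun t =>
    \sum_(m <- msupp P) mcoeff m P * \prod_j x t 0 j ^+ m j).
  apply: polyfun_sum => m; apply: polyfunM; first exact: polyfun_cst.
  by apply: polyfun_prod => j; exact: polyfunX.
by apply/funext => t; rewrite evE.
Qed.

Lemma polyfun_chart_pt (T : lmodType K) i (z : T -> 'rV[K]_n) j :
  (forall k, polyfun (fun t => z t 0 k)) -> polyfun (fun t => chart_pt i (z t) 0 j).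
Proof.
move=> hz; case: (unliftP i j) => [k ->|->].
  rewrite (_ : (fun _ => _) = fun t => z t 0 k)//.
  by apply/funext => t; rewrite chart_pt_lift.
rewrite (_ : (fun _ => _) = fun=> 1); first exact: polyfun_cst.
by apply/funext => t; rewrite chart_pt_i.
Qed.

Lemma polyfun_ev (T : lmodType K) i (z : T -> 'rV[K]_n) P :
  (forall k, polyfun (fun t => z t 0 k)) ->
  polyfun (fun t => ev P (chart_pt i (z t))).
Proof. by move=> hz; apply: polyfun_ev_comp => j; exact: polyfun_chart_pt. Qed.

Definition singular_in_chart d i : set (dhomog n.+1 K d) :=
  [set F : dhomog n.+1 K d | exists z, ev F (chart_pt i z) = 0 /\
             forall k, ev (pd i k F) (chart_pt i z) = 0].

(** [n + 1] conditions, independent by interpolation of a 1-jet, against the [n] coordinates of the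
    point. *)
Lemma thin_singular d i : (0 < d)%N -> thin (@singular_in_chart d i).
Proof.
move=> d0; pose L (r : option 'I_n) z (F : dhomog n.+1 K d) : K :=
  if r is Some k then ev (pd i k F) (chart_pt i z) else ev F (chart_pt i z).
apply: thinS (@thin_incidence _ _ _ _ L (fun _ _ => 0) _ _ _ _).
- move=> F [z [F0 F1]]; exists z; split; last by case.
  move=> u; have [P hP [P0 P1 _]] := jet1_interpolation (chart_pt_i i z) (u None)
    (fun k => u (Some k)) d0.
  by exists (DHomog hP) => -[k|] /=; rewrite ?P0 ?P1.
- by case=> [k|] z; [exact: scalar_pd|exact: scalar_ev].
- by case=> [k|] F; apply: polyfun_ev => l; apply: polyfun_lin; exact: scalar_coef.
- by move=> r; exact: polyfun_cst.
- by rewrite dim_row card_option card_ord.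
Qed.

(** Proportionality in this direction captures tangency where the gradient of the first form is
    nonzero; the other case is left to [singular_in_chart]. The factor [s] is the one parameter
    besides the point, against [n + 2] conditions. *)
Definition tangent_in_chart i : set (PA * PB) :=
  [set v : PA * PB | exists z s, [/\ ev v.1 (chart_pt i z) = 0, ev v.2 (chart_pt i z) = 0 &
             forall k, ev (pd i k v.2) (chart_pt i z) =
                       s * ev (pd i k v.1) (chart_pt i z)]].

Lemma thin_tangent i : thin (tangent_in_chart i).
Proof.
pose L (r : option (option 'I_n)) (t : 'rV[K]_n * K^o) (v : PA * PB) : K :=
  match r with
  | None => ev v.1 (chart_pt i t.1)
  | Some None => ev v.2 (chart_pt i t.1)
  | Some (Some k) => ev (pd i k v.2) (chart_pt i t.1) -
                     t.2 * ev (pd i k v.1) (chart_pt i t.1)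
  end.
apply: thinS (@thin_incidence _ _ _ _ L (fun _ _ => 0) _ _ _ _).
- move=> v [z [s [v1 v2 dv]]]; exists (z, s); split; last first.
    by move=> [[k|]|] //=; rewrite dv subrr.
  move=> u; have [P hP [P0 P1 _]] := jet1_interpolation (chart_pt_i i z) (u None)
    (fun=> 0) a0.
  have [Q hQ [Q0 Q1 _]] := jet1_interpolation (chart_pt_i i z) (u (Some None))
    (fun k => u (Some (Some k))) b0.
  exists (DHomog hP, DHomog hQ) => -[[k|]|] //=.
  by rewrite P1 Q1 mulr0 subr0.
- move=> [[k|]|] t /=.
  + apply: scalarB; first by move=> ? ? ?; exact: scalar_pd.
    by apply: scalar_mull => ? ? ?; exact: scalar_pd.
  + by move=> ? ? ?; exact: scalar_ev.
  + by move=> ? ? ?; exact: scalar_ev.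
- have pz k : polyfun (fun t : 'rV[K]_n * K^o => t.1 0 k).
    by apply: polyfun_lin; by move=> ? ? ?; exact: scalar_coef.
  move=> [[k|]|] v /=; [|exact: (polyfun_ev _ _ pz)|exact: (polyfun_ev _ _ pz)].
  apply: polyfunB; first exact: (polyfun_ev _ _ pz).
  apply: polyfunM; last exact: (polyfun_ev _ _ pz).
  by apply: polyfun_lin; by move=> ? ? ?; exact: scalar_id.
- by move=> r; exact: polyfun_cst.
- by rewrite dim_pair dim_row dim_regular addn1 !card_option card_ord.
Qed.

(** The equation p dF/F = q dG/G, that is the vanishing of the logarithmic derivative of F^p/G^q,
    cleared of denominators. *)
Definition critical_at i z (v : PA * PB) :=
  [/\ ev v.1 (chart_pt i z) != 0, ev v.2 (chart_pt i z) != 0 &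
    forall k, p%:R * ev v.2 (chart_pt i z) * ev (pd i k v.1) (chart_pt i z) =
              q%:R * ev v.1 (chart_pt i z) * ev (pd i k v.2) (chart_pt i z)].

(* For a fixed ratio [rho] of the values, being critical is a linear condition. *)
Lemma critical_at_ratio i z v : critical_at i z v ->
  exists2 rho, rho != 0 & [/\ ev v.1 (chart_pt i z) != 0,
    ev v.2 (chart_pt i z) = rho * ev v.1 (chart_pt i z) &
    forall k, q%:R * ev (pd i k v.2) (chart_pt i z) =
              p%:R * rho * ev (pd i k v.1) (chart_pt i z)].
Proof.
move=> [f0 g0 crit]; exists (ev v.2 (chart_pt i z) / ev v.1 (chart_pt i z)).
  by rewrite mulf_neq0// invr_eq0.
split=> [//||k]; first by rewrite divfK.
by apply: (mulfI f0); rewrite mulrCA mulrA -crit; field.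
Qed.

(** [n + 2] conditions, one of them fixing the adjoined coordinate, against the [n + 1] parameters
    [z] and [rho]. *)
Lemma thin_critical_coordinate i k0 :
  thin [set w : (PA * PB) * K^o | exists z, critical_at i z w.1 /\ w.2 = z 0 k0].
Proof.
pose L0 (r : option 'I_n) (t : 'rV[K]_n * K^o) (v : PA * PB) : K :=
  if r is Some k then p%:R * t.2 * ev (pd i k v.1) (chart_pt i t.1) -
                      q%:R * ev (pd i k v.2) (chart_pt i t.1)
  else ev v.2 (chart_pt i t.1) - t.2 * ev v.1 (chart_pt i t.1).
pose L (r : option (option 'I_n)) (t : 'rV[K]_n * K^o) (w : (PA * PB) * K^o) : K :=
  if r is Some r' then L0 r' t w.1 else w.2.
have L0l r t : scalar (L0 r t).
  case: r => [k|]; apply: scalarB.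
  - by apply: scalar_mull => ? ? ?; exact: scalar_pd.
  - by apply: scalar_mull => ? ? ?; exact: scalar_pd.
  - by move=> ? ? ?; exact: scalar_ev.
  - by apply: scalar_mull => ? ? ?; exact: scalar_ev.
pose c (r : option (option 'I_n)) (t : 'rV[K]_n * K^o) : K :=
  if r is None then t.1 0 k0 else 0.
apply: thinS (@thin_incidence _ _ _ _ L c _ _ _ _).
- move=> w [z [/critical_at_ratio[rho rho0 [f0 g0 crit]] wz]]; exists (z, rho); split.
    move=> u.
    have [P hP [P0 P1 _]] := jet1_interpolation (chart_pt_i i z) 0 (fun=> 0) a0.
    have [Q hQ [Q0 Q1 _]] := jet1_interpolation (chart_pt_i i z) (u (Some None))
      (fun k => - u (Some (Some k)) / q%:R) b0.
    exists (DHomog hP, DHomog hQ, u None) => -[[k|]|] //=.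
      by rewrite P1 Q1; field.
    by rewrite P0 Q0; ring.
  move=> [[k|]|] //=; first by rewrite crit; ring.
  by rewrite g0; ring.
- by move=> [r|] t k u v; [exact: (L0l r t k u.1 v.1)|].
- have pz k : polyfun (fun t : 'rV[K]_n * K^o => t.1 0 k).
    by apply: polyfun_lin; by move=> ? ? ?; exact: scalar_coef.
  have prho : polyfun (fun t : 'rV[K]_n * K^o => t.2 : K).
    by apply: polyfun_lin; by move=> ? ? ?; exact: scalar_id.
  move=> [[k|]|] w /=; last exact: polyfun_cst.
    by apply: polyfunB; apply: polyfunM; try (exact: (polyfun_ev _ _ pz));
      try (exact: polyfun_cst); apply: polyfunM => //; exact: polyfun_cst.
  by apply: polyfunB; [|apply: polyfunM => //]; exact: (polyfun_ev _ _ pz).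
- move=> [[k|]|]; try exact: polyfun_cst.
  by apply: polyfun_lin; by move=> ? ? ?; exact: scalar_coef.
- by rewrite dim_pair dim_row dim_regular addn1 !card_option card_ord.
Qed.

Definition equal_values i i' : set (PA * PB) :=
  [set v | exists z z', [/\ independent_points (chart_pt i z) (chart_pt i' z'),
     critical_at i z v, critical_at i' z' v &
     ev v.1 (chart_pt i z) ^+ p * ev v.2 (chart_pt i' z') ^+ q =
     ev v.1 (chart_pt i' z') ^+ p * ev v.2 (chart_pt i z) ^+ q]].

(** Bezout gives [u * p = v * q + 1], and [m = t ^+ u / s ^+ v] works. *)
Lemma common_root (F : fieldType) (s t : F) : coprime p q -> s != 0 -> t != 0 ->
  s ^+ p = t ^+ q -> exists2 m, m != 0 & m ^+ q = s /\ m ^+ p = t.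
Proof.
move=> pq s0 t0 st; have [u v uv _] := egcdnP q p0.
rewrite (eqP pq : gcdn p q = 1%N) in uv.
exists (t ^+ u / s ^+ v); first by rewrite mulf_neq0 ?invr_eq0 ?expf_neq0.
rewrite !exprMn !exprVn; split.
  rewrite -exprM mulnC exprM -st -exprM mulnC uv -exprM exprD expr1.
  by rewrite mulrAC mulfV ?mul1r// expf_neq0.
rewrite -[in X in _ / X]exprM [(v * p)%N]mulnC exprM st -!exprM uv exprD expr1.
rewrite [(q * v)%N]mulnC.
by rewrite mulrAC mulfV ?mul1r// expf_neq0.
Qed.

(* This turns the equality of two critical values into two linear conditions. *)
Lemma proportional_values (F : fieldType) (f g f' g' : F) : coprime p q ->
  f != 0 -> g != 0 -> f' != 0 -> g' != 0 -> f ^+ p * g' ^+ q = f' ^+ p * g ^+ q ->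
  exists2 mu, mu != 0 & f' = mu ^+ q * f /\ g' = mu ^+ p * g.
Proof.
move=> pq f0 g0 f0' g0' val.
have [mu mu0 [muq mup]] : exists2 mu, mu != 0 & mu ^+ q = f' / f /\ mu ^+ p = g' / g.
  apply: common_root => //; rewrite ?mulf_neq0 ?invr_eq0//.
  by rewrite !exprMn !exprVn; apply/eqP; rewrite eqr_div ?expf_neq0// -val mulrC.
by exists mu => //; rewrite muq mup !divfK.
Qed.

(** At the second point the ratio of the values is [rho * mu ^+ p / mu ^+ q]. Hence for fixed
    points, [rho] and [mu], all conditions are linear in the pair of forms. *)
Lemma equal_valuesP i i' v : coprime p q -> equal_values i i' v ->
  exists z z' rho mu, [/\ independent_points (chart_pt i z) (chart_pt i' z'),
    rho != 0, mu != 0, ev v.1 (chart_pt i z) != 0 &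
    [/\ ev v.2 (chart_pt i z) = rho * ev v.1 (chart_pt i z),
        forall k, q%:R * ev (pd i k v.2) (chart_pt i z) =
              p%:R * rho * ev (pd i k v.1) (chart_pt i z),
        ev v.1 (chart_pt i' z') = mu ^+ q * ev v.1 (chart_pt i z),
        ev v.2 (chart_pt i' z') = mu ^+ p * ev v.2 (chart_pt i z) &
        forall k, q%:R * mu ^+ q * ev (pd i' k v.2) (chart_pt i' z') =
              p%:R * rho * mu ^+ p * ev (pd i' k v.1) (chart_pt i' z')]].
Proof.
move=> pq [z [z' [ind crit crit' val]]].
have [rho rho0 [f0 g0 gk]] := critical_at_ratio crit.
have [f0' g0' crit1'] := crit'.
have [_ gn0 _] := crit.
have [mu mu0 [fE gE]] := proportional_values pq f0 gn0 f0' g0' val.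
exists z, z', rho, mu; split=> //; split=> // k.
apply: (mulfI f0); have := crit1' k; rewrite {1}fE {1}gE g0 => E.
by transitivity (q%:R * (mu ^+ q * ev v.1 (chart_pt i z)) *
  ev (pd i' k v.2) (chart_pt i' z')); [ring|rewrite -E; ring].
Qed.

(** [2n + 3] conditions against [2n + 2] parameters. One form of degree above 2 is enough: the other
    is only given its two values, and the gradients it happens to have are compensated by those of
    the first. *)
Lemma thin_equal_values i i' : coprime p q -> (2 < a)%N \/ (2 < b)%N ->
  thin (equal_values i i').
Proof.
move=> pq ab.
pose T := (('rV[K]_n * 'rV[K]_n) * (K^o * K^o))%type.
pose L (r : option 'I_n + option (option 'I_n)) (t : T) (v : PA * PB) : K :=
  match r with
  | inl None => ev v.2 (chart_pt i t.1.1) - t.2.1 * ev v.1 (chart_pt i t.1.1)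
  | inl (Some k) => p%:R * t.2.1 * ev (pd i k v.1) (chart_pt i t.1.1) -
                    q%:R * ev (pd i k v.2) (chart_pt i t.1.1)
  | inr None => ev v.1 (chart_pt i' t.1.2) - t.2.2 ^+ q * ev v.1 (chart_pt i t.1.1)
  | inr (Some None) =>
      ev v.2 (chart_pt i' t.1.2) - t.2.2 ^+ p * ev v.2 (chart_pt i t.1.1)
  | inr (Some (Some k)) =>
      p%:R * t.2.1 * t.2.2 ^+ p * ev (pd i' k v.1) (chart_pt i' t.1.2) -
      q%:R * t.2.2 ^+ q * ev (pd i' k v.2) (chart_pt i' t.1.2)
  end.
apply: thinS (@thin_incidence _ _ _ _ L (fun _ _ => 0) _ _ _ _).
- move=> v /(equal_valuesP pq)[z [z' [rho [mu [ind rho0 mu0 f0 [g0 gk f' g' gk']]]]]].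
  exists (z, z', (rho, mu)); split; last first.
    move=> [[k|]|[[k|]|]] /=.
    + by rewrite gk subrr.
    + by rewrite g0 subrr.
    + by rewrite gk' subrr.
    + by rewrite g' subrr.
    + by rewrite f' subrr.
  move=> u; have xi := chart_pt_i i z; have xi' := chart_pt_i i' z'.
  have mup : mu ^+ p != 0 by rewrite expf_neq0.
  have muq : mu ^+ q != 0 by rewrite expf_neq0.
  case: ab => [a2|b2].
  + have [Q hQ [Q0 Q0']] := value_interpolation (u (inl None))
      (u (inr (Some None)) + mu ^+ p * u (inl None)) b0 ind.
    have [P hP [P0 P0' P1 P1']] := jet1_interpolation2 0 (u (inr None))
      (fun k => (u (inl (Some k)) + q%:R * ev (pd i k Q) (chart_pt i z)) / (p%:R * rho))
      (fun k => (u (inr (Some (Some k))) +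
         q%:R * mu ^+ q * ev (pd i' k Q) (chart_pt i' z')) / (p%:R * rho * mu ^+ p))
      a2 xi xi' ind.
    exists (DHomog hP, DHomog hQ) => -[[k|]|[[k|]|]] /=.
    * by rewrite P1; field; rewrite rho0 pK.
    * by rewrite P0 Q0; ring.
    * by rewrite P1'; field; rewrite rho0 pK mup.
    * by rewrite Q0 Q0'; ring.
    * by rewrite P0 P0'; ring.
  + have [P hP [P0 P0']] := value_interpolation 0 (u (inr None)) a0 ind.
    have [Q hQ [Q0 Q0' Q1 Q1']] := jet1_interpolation2 (u (inl None))
      (u (inr (Some None)) + mu ^+ p * u (inl None))
      (fun k => (p%:R * rho * ev (pd i k P) (chart_pt i z) - u (inl (Some k))) / q%:R)
      (fun k => (p%:R * rho * mu ^+ p * ev (pd i' k P) (chart_pt i' z') -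
         u (inr (Some (Some k)))) / (q%:R * mu ^+ q))
      b2 xi xi' ind.
    exists (DHomog hP, DHomog hQ) => -[[k|]|[[k|]|]] /=.
    * by rewrite Q1; field.
    * by rewrite P0 Q0; ring.
    * by rewrite Q1'; field; rewrite qK muq.
    * by rewrite Q0 Q0'; ring.
    * by rewrite P0 P0'; ring.
- move=> [[k|]|[[k|]|]] t /=.
  + by apply: scalarB; apply: scalar_mull => ? ? ?; exact: scalar_pd.
  + apply: scalarB; first by move=> ? ? ?; exact: scalar_ev.
    by apply: scalar_mull => ? ? ?; exact: scalar_ev.
  + by apply: scalarB; apply: scalar_mull => ? ? ?; exact: scalar_pd.
  + apply: scalarB; first by move=> ? ? ?; exact: scalar_ev.
    by apply: scalar_mull => ? ? ?; exact: scalar_ev.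
  + apply: scalarB; first by move=> ? ? ?; exact: scalar_ev.
    by apply: scalar_mull => ? ? ?; exact: scalar_ev.
- have pz k : polyfun (fun t : T => t.1.1 0 k).
    by apply: polyfun_lin; by move=> ? ? ?; exact: scalar_coef.
  have pz' k : polyfun (fun t : T => t.1.2 0 k).
    by apply: polyfun_lin; by move=> ? ? ?; exact: scalar_coef.
  have prho : polyfun (fun t : T => t.2.1 : K).
    by apply: polyfun_lin; by move=> ? ? ?; exact: scalar_id.
  have pmu m : polyfun (fun t : T => (t.2.2 : K) ^+ m).
    by apply: polyfunX; apply: polyfun_lin; by move=> ? ? ?; exact: scalar_id.
  have pev P : polyfun (fun t : T => ev P (chart_pt i t.1.1)).
    exact: (polyfun_ev _ _ pz).
  have pev' P : polyfun (fun t : T => ev P (chart_pt i' t.1.2)).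
    exact: (polyfun_ev _ _ pz').
  have pc c : polyfun (fun _ : T => c : K) by exact: polyfun_cst.
  by move=> [[k|]|[[k|]|]] v /=; apply: polyfunB => //; repeat (apply: polyfunM => //).
- by move=> r; exact: polyfun_cst.
- rewrite !dim_pair !dim_row !dim_regular card_sum !card_option card_ord.
  by rewrite !addnS !addn0 !addSn.
Qed.

End DegeneracyLoci.

(** The numerator of the k-th partial derivative of F^p/G^q. At a critical point the Hessian is, up
    to a nonzero factor, the matrix of derivatives of these forms, which [degenerate] uses in its
    place. *)
Definition critical_form (K : numFieldType) n (p q : nat) i (k : 'I_n)
    (F G : mpoly n.+1 K) : mpoly n.+1 K :=
  p%:R *: (G * pd i k F) - q%:R *: (F * pd i k G).

Definition degenerate (K : numFieldType) n a b (p q : nat) i :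
    set (dhomog n.+1 K a * dhomog n.+1 K b) :=
  [set v | exists z (u : 'rV[K]_n), [/\ critical_at p q i z v, u != 0 &
     forall k, \sum_l u 0 l * ev (pd i l (critical_form p q i k v.1 v.2)) (chart_pt i z) = 0]].

Section Degenerate.
Variables (K : numFieldType) (m a b p q : nat).
Local Notation n := m.+1.
Local Notation PA := (dhomog n.+1 K a).
Local Notation PB := (dhomog n.+1 K b).
Hypotheses (a0 : (0 < a)%N) (b0 : (0 < b)%N) (p0 : (0 < p)%N) (q0 : (0 < q)%N).

Let pK : p%:R != 0 :> K. Proof. by rewrite pnatr_eq0 -lt0n. Qed.
Let qK : q%:R != 0 :> K. Proof. by rewrite pnatr_eq0 -lt0n. Qed.

Lemma ev_pd_critical_form i l k (v : PA * PB) x :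
  ev (pd i l (critical_form p q i k v.1 v.2)) x =
  p%:R * (ev (pd i l v.2) x * ev (pd i k v.1) x + ev v.2 x * ev (pd i l (pd i k v.1)) x) -
  q%:R * (ev (pd i l v.1) x * ev (pd i k v.2) x + ev v.1 x * ev (pd i l (pd i k v.2)) x).
Proof.
by rewrite /critical_form -scaleNr pdD !pdZ !pdM !(evD, evZ, evM); ring.
Qed.

(* With [u] normalized by [u j = 1] and [tau] the ratio of [dF.u] to [F], the
   degeneracy of the Hessian is linear in [(F, G)] for fixed parameters. *)
Lemma degenerateP i (v : PA * PB) : degenerate p q i v ->
  exists j z (u' : 'rV[K]_m) rho tau, rho != 0 /\ let x := chart_pt i z in
    let u l := chart_pt j u' 0 l in
    [/\ ev v.2 x = rho * ev v.1 x,
        forall k, q%:R * ev (pd i k v.2) x = p%:R * rho * ev (pd i k v.1) x,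
        \sum_l u l * ev (pd i l v.1) x = tau * ev v.1 x &
        forall k, p%:R * rho * (p%:R - q%:R) * tau * ev (pd i k v.1) x +
          p%:R * q%:R * rho * \sum_l u l * ev (pd i k (pd i l v.1)) x -
          q%:R ^+ 2 * \sum_l u l * ev (pd i k (pd i l v.2)) x = 0].
Proof.
move=> [z [u0 [crit /rV0Pn[j uj] deg]]].
have [rho rho0 [f0 g0 gk]] := critical_at_ratio crit.
pose u l := (u0 0 j)^-1 * u0 0 l.
pose u' : 'rV[K]_m := \row_l u (lift j l).
have uE l : chart_pt j u' 0 l = u l.
  case: (unliftP j l) => [l' ->|->]; first by rewrite chart_pt_lift mxE.
  by rewrite chart_pt_i /u mulVf.
set x := chart_pt i z in f0 g0 gk deg *.
pose tau := (\sum_l u l * ev (pd i l v.1) x) / ev v.1 x.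
exists j, z, u', rho, tau; split=> //=.
have fu : \sum_l u l * ev (pd i l v.1) x = tau * ev v.1 x by rewrite divfK.
have gu : q%:R * \sum_l u l * ev (pd i l v.2) x = p%:R * rho * (tau * ev v.1 x).
  by rewrite -fu !mulr_sumr; apply: eq_bigr => l _; rewrite mulrCA gk; ring.
split=> // [|k]; first by rewrite -fu; apply: eq_bigr => l _; rewrite uE.
under eq_bigr do rewrite uE pd_comm.
under [X in _ - _ * X]eq_bigr do rewrite uE pd_comm.
set S := \sum_l _; set S' := \sum_l _.
have : p%:R * (\sum_l u l * ev (pd i l v.2) x * ev (pd i k v.1) x + ev v.2 x * S) -
    q%:R * ((\sum_l u l * ev (pd i l v.1) x) * ev (pd i k v.2) x + ev v.1 x * S') = 0.
  transitivity ((u0 0 j)^-1 *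
    \sum_l u0 0 l * ev (pd i l (critical_form p q i k v.1 v.2)) x); last first.
    by rewrite deg mulr0.
  rewrite /S /S' !mulr_suml !mulr_sumr -!big_split /= !mulr_sumr -sumrB.
  by apply: eq_bigr => l _; rewrite ev_pd_critical_form /u; ring.
rewrite -mulr_suml fu g0 => E; apply: (mulfI f0); rewrite mulr0.
rewrite -[RHS](mulr0 q%:R) -E.
transitivity (p%:R * (p%:R * rho * (tau * ev v.1 x)) * ev (pd i k v.1) x +
  p%:R * q%:R * rho * ev v.1 x * S - q%:R * (tau * ev v.1 x) *
  (p%:R * rho * ev (pd i k v.1) x) - q%:R ^+ 2 * ev v.1 x * S'); first by ring.
by rewrite -gu -gk; ring.
Qed.

(** [2n + 2] conditions against [2n + 1] parameters: the point, a direction in one of finitely many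
    affine charts [j] ([n - 1] coordinates), [rho] and [tau]. Only one form has to carry a
    prescribed 2-jet. *)
Lemma thin_degenerate i : (1 < a)%N \/ (1 < b)%N ->
  thin (@degenerate K n a b p q i).
Proof.
move=> ab.
pose T := (('rV[K]_n * 'rV[K]_m) * (K^o * K^o))%type.
pose L j (r : option 'I_n + option 'I_n) (t : T) (v : PA * PB) : K :=
  let x := chart_pt i t.1.1 in let u := chart_pt j t.1.2 in
  match r with
  | inl None => ev v.2 x - t.2.1 * ev v.1 x
  | inl (Some k) => p%:R * t.2.1 * ev (pd i k v.1) x - q%:R * ev (pd i k v.2) x
  | inr None => \sum_l u 0 l * ev (pd i l v.1) x - t.2.2 * ev v.1 x
  | inr (Some k) => p%:R * t.2.1 * (p%:R - q%:R) * t.2.2 * ev (pd i k v.1) x +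
          p%:R * q%:R * t.2.1 * (\sum_l u 0 l * ev (pd i k (pd i l v.1)) x) -
          q%:R ^+ 2 * (\sum_l u 0 l * ev (pd i k (pd i l v.2)) x)
  end.
pose B j := [set v : PA * PB | exists t,
  (forall w, exists v', forall r, L j r t v' = w r) /\ forall r, L j r t v = 0].
apply: (@thinS _ _ _ [set v | exists j, B j v]).
  move=> v /degenerateP[j [z [u' [rho [tau [rho0 /= [g0 gk fu deg]]]]]]].
  exists j, (z, u', (rho, tau)); split; last first.
    move=> [[k|]|[k|]] /=.
    - by rewrite gk subrr.
    - by rewrite g0 subrr.
    - exact: deg.
    - by rewrite fu subrr.
  move=> w; have xi := chart_pt_i i z; have uj := chart_pt_i j u'.
  (* As the direction has j-th coordinate 1, this gradient pairs with it to [w (inr None)]. *)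
  pose f1 l := w (inr None) * (l == j)%:R.
  have sumf1 (h : 'I_n -> K) : (forall l, h l = f1 l) ->
      \sum_l chart_pt j u' 0 l * h l = w (inr None).
    move=> hE; rewrite (bigD1 j)//= uj hE /f1 eqxx !mulr1 mul1r big1 ?addr0//.
    by move=> l /negPf lj; rewrite hE /f1 lj !mulr0.
  have sum0 (h : 'I_n -> K) : (forall l, h l = 0) ->
      \sum_l chart_pt j u' 0 l * h l = 0.
    by move=> hE; rewrite big1// => l _; rewrite hE mulr0.
  pose g1 k := (p%:R * rho * f1 k - w (inl (Some k))) / q%:R.
  case: ab => [a2|b2].
    have [Q hQ [Q0 Q1 Q2]] := jet1_interpolation xi (w (inl None)) g1 b0.
    have [P hP [P0 P1 P2]] := jet2_interpolation xi 0 f1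
      (fun k => (w (inr (Some k)) - p%:R * rho * (p%:R - q%:R) * tau * f1 k) /
                (p%:R * q%:R * rho)) a2 uj.
    exists (DHomog hP, DHomog hQ) => -[[k|]|[k|]] /=.
    - by rewrite P1 Q1 /g1; field.
    - by rewrite P0 Q0; ring.
    - by rewrite P1 P2 sum0//; field; rewrite rho0 qK pK.
    - by rewrite sumf1// P0; ring.
  have [P hP [P0 P1 P2]] := jet1_interpolation xi 0 f1 a0.
  have [Q hQ [Q0 Q1 Q2]] := jet2_interpolation xi (w (inl None)) g1
    (fun k => (p%:R * rho * (p%:R - q%:R) * tau * f1 k - w (inr (Some k))) / q%:R ^+ 2)
    b2 uj.
  exists (DHomog hP, DHomog hQ) => -[[k|]|[k|]] /=.
  - by rewrite P1 Q1 /g1; field.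
  - by rewrite P0 Q0; ring.
  - by rewrite P1 sum0// Q2; field.
  - by rewrite sumf1// P0; ring.
apply: thin_bigcup => j.
apply: (@thin_incidence _ _ _ _ (L j) (fun _ _ => 0)).
- move=> [[k|]|[k|]] t /=.
  + by apply: scalarB; apply: scalar_mull => ? ? ?; exact: scalar_pd.
  + apply: scalarB; first by move=> ? ? ?; exact: scalar_ev.
    by apply: scalar_mull => ? ? ?; exact: scalar_ev.
  + apply: scalarB; [apply: scalarD|]; apply: scalar_mull.
    * by move=> ? ? ?; exact: scalar_pd.
    * by apply: scalar_sum => l; apply: scalar_mull => ? ? ?; exact: scalar_pd2.
    * by apply: scalar_sum => l; apply: scalar_mull => ? ? ?; exact: scalar_pd2.
  + apply: scalarB; last by apply: scalar_mull => ? ? ?; exact: scalar_ev.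
    by apply: scalar_sum => l; apply: scalar_mull => ? ? ?; exact: scalar_pd.
- have pz k : polyfun (fun t : T => t.1.1 0 k).
    by apply: polyfun_lin => ? ? ?; exact: scalar_coef.
  have pu l : polyfun (fun t : T => chart_pt j t.1.2 0 l).
    apply: (@polyfun_chart_pt K m T j (fun t => t.1.2)) => l'.
    by apply: polyfun_lin => ? ? ?; exact: scalar_coef.
  have prho : polyfun (fun t : T => t.2.1 : K) by apply: polyfun_lin.
  have ptau : polyfun (fun t : T => t.2.2 : K) by apply: polyfun_lin.
  have pev P : polyfun (fun t : T => ev P (chart_pt i t.1.1)).
    exact: (polyfun_ev _ _ pz).
  have pc c : polyfun (fun _ : T => c : K) by exact: polyfun_cst.
  have psum (h : 'I_n -> mpoly n.+1 K) : polyfun (fun t : T =>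
      \sum_l chart_pt j t.1.2 0 l * ev (h l) (chart_pt i t.1.1)).
    by apply: polyfun_sum => l; exact: polyfunM.
  move=> [[k|]|[k|]] v /=; apply: polyfunB; try exact: psum.
  + by repeat (apply: polyfunM => //).
  + by repeat (apply: polyfunM => //).
  + by [].
  + by repeat (apply: polyfunM => //).
  + apply: polyfunD; first by repeat (apply: polyfunM => //).
    by apply: polyfunM; [repeat (apply: polyfunM => //)|exact: psum].
  + by apply: polyfunM; [exact: pc|exact: psum].
  + exact: polyfunM.
- by move=> r; exact: polyfun_cst.
- rewrite !dim_pair !dim_row !dim_regular card_sum !card_option card_ord.
  by rewrite !addnS !addn0 !addSn.
Qed.

End Degenerate.

(** * Finite sets of roots and of row vectors *)

Section Finiteness.
Variable K : numFieldType.

Lemma finite_roots (P : {poly K}) : P != 0 -> finite_set [set x | P.[x] = 0].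
Proof.
move=> P0; apply: contrapT => /(infinite_set_fset (size P)) [B BP].
apply/negP; rewrite -ltnNge; apply: max_poly_roots => //.
  by apply/allP => x xB; apply/rootP/BP.
exact: finmap.fset_uniq.
Qed.

Lemma infinite_numField : ~ finite_set [set: K].
Proof.
move=> fK; apply: infinite_nat; rewrite -(preimage_setT (fun k : nat => k%:R : K)).
apply: finite_preimage => // i j _ _ /eqP.
by rewrite eqr_nat => /eqP.
Qed.

Lemma finite_row_set n (A : set 'rV[K]_n) :
  (forall k, finite_set [set z 0 k | z in A]) -> finite_set A.
Proof.
move=> fA.
have [s sP] := choice (fun k => (finite_seqP _).1 (fA k)).
pose S := flatten [seq s k | k : 'I_n].
pose g (f : {ffun 'I_n -> 'I_(size S)}) : 'rV[K]_n := \row_k nth 0 S (f k).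
apply: (@sub_finite_set _ _ (g @` setT)); last exact/finite_image/finite_finset.
move=> z Az; have zS k : z 0 k \in S.
  apply/flattenP; exists (s k); first by apply/mapP; exists k; rewrite ?mem_enum.
  have : [set z 0 k | z in A] (z 0 k) by exists z.
  by rewrite sP.
have zi k : (index (z 0%R k) S < size S)%N by rewrite index_mem.
exists [ffun k => Ordinal (zi k)] => //.
by apply/rowP => k; rewrite mxE ffunE /= nth_index.
Qed.

End Finiteness.

(** * Finiteness of the critical set and critical points in low degree *)

Section SmallDegree.
Variables (K : numFieldType) (n a b p q : nat).
Local Notation PA := (dhomog n.+1 K a).
Local Notation PB := (dhomog n.+1 K b).
Hypotheses (a0 : (0 < a)%N) (b0 : (0 < b)%N) (p0 : (0 < p)%N) (q0 : (0 < q)%N).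
Hypothesis abpq : (a * p = b * q)%N.
Implicit Types (v : PA * PB) (i : 'I_n.+1) (x y : 'rV[K]_n.+1).

Definition gradient_condition v x := forall j,
  p%:R * ev v.2 x * ev (mderiv j v.1) x = q%:R * ev v.1 x * ev (mderiv j v.2) x.

Let dhomogF v : (v.1 : mpoly n.+1 K) \is homog a.
Proof. exact: dhomog_is_dhomog. Qed.

Let dhomogG v : (v.2 : mpoly n.+1 K) \is homog b.
Proof. exact: dhomog_is_dhomog. Qed.

Let paqb : p%:R * a%:R = q%:R * b%:R :> K.
Proof. by rewrite -!natrM mulnC abpq mulnC. Qed.

(** The chart omits the i-th partial derivative. By Euler's identity and [a * p = b * q] the radial
    combination of the conditions is automatic, and as the i-th coordinate is 1 it yields the
    missing one. *)
Lemma critical_at_gradient i z v :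
  critical_at p q i z v -> gradient_condition v (chart_pt i z).
Proof.
move=> [f0 g0 crit]; set x := chart_pt i z in f0 g0 crit *.
have H k : p%:R * ev v.2 x * ev (mderiv (lift i k) v.1) x =
    q%:R * ev v.1 x * ev (mderiv (lift i k) v.2) x by rewrite -!pd_mderiv.
move=> j; case: (unliftP i j) => [k -> //|->].
have Ea := euler_identity x (dhomogF v); have Eb := euler_identity x (dhomogG v).
have : \sum_j x 0 j * (p%:R * ev v.2 x * ev (mderiv j v.1) x -
    q%:R * ev v.1 x * ev (mderiv j v.2) x) = 0.
  transitivity (p%:R * ev v.2 x * (\sum_j x 0 j * ev (mderiv j v.1) x) -
    q%:R * ev v.1 x * (\sum_j x 0 j * ev (mderiv j v.2) x)).
    rewrite !mulr_sumr -sumrB; apply: eq_bigr => l _; ring.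
  rewrite Ea Eb; transitivity (ev v.2 x * ev v.1 x * (p%:R * a%:R - q%:R * b%:R)).
    by ring.
  by rewrite paqb subrr mulr0.
rewrite (bigD1 i)//= big1 ?addr0 => [|l li].
  by rewrite chart_pt_i mul1r => /eqP; rewrite subr_eq0 => /eqP.
case: (unliftP i l) li => [k -> _|->]; last by rewrite eqxx.
by rewrite H subrr mulr0.
Qed.

Lemma gradient_critical_at i x v : x 0 i != 0 -> ev v.1 x != 0 -> ev v.2 x != 0 ->
  gradient_condition v x ->
  critical_at p q i (\row_k ((x 0 i)^-1 * x 0 (lift i k))) v.
Proof.
move=> xi f0 g0 grad.
have cE : chart_pt i (\row_k ((x 0 i)^-1 * x 0 (lift i k))) = (x 0 i)^-1 *: x.
  apply/rowP => j; rewrite [RHS]mxE; case: (unliftP i j) => [k ->|->].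
    by rewrite chart_pt_lift mxE.
  by rewrite chart_pt_i mulVf.
have c0 : (x 0 i)^-1 != 0 by rewrite invr_eq0.
rewrite /critical_at cE; move: (x 0 i)^-1 c0 => c c0.
split=> [||k].
- by rewrite (ev_homogZ _ _ (dhomogF v)) mulf_neq0// expf_neq0.
- by rewrite (ev_homogZ _ _ (dhomogG v)) mulf_neq0// expf_neq0.
- rewrite !pd_mderiv (ev_homogZ _ _ (dhomogF v)) (ev_homogZ _ _ (dhomogG v)).
  rewrite (ev_homogZ _ _ (homog_mderiv _ (dhomogF v))).
  rewrite (ev_homogZ _ _ (homog_mderiv _ (dhomogG v))).
  have -> : c ^+ b = c * c ^+ b.-1 by rewrite -exprS prednK.
  have -> : c ^+ a = c * c ^+ a.-1 by rewrite -exprS prednK.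
  transitivity (c * c ^+ b.-1 * c ^+ a.-1 *
    (p%:R * ev v.2 x * ev (mderiv (lift i k) v.1) x)); first by ring.
  by rewrite grad; ring.
Qed.

Lemma polyfun_ev_row (P : mpoly n.+1 K) : polyfun (fun x : 'rV[K]_n.+1 => ev P x).
Proof.
by apply: (polyfun_ev_comp (x := id)) => j; apply: polyfun_lin; exact: scalar_coef.
Qed.

(* In degree at most 2 the partial derivatives are affine, so that a whole line
   of points is critical as soon as two of its points are. *)
Lemma critical_line i z v y : (a <= 2)%N -> (b <= 2)%N ->
  critical_at p q i z v -> independent_points (chart_pt i z) y ->
  (forall j, p%:R * ev v.2 (chart_pt i z) * ev (mderiv j v.1) y =
             q%:R * ev v.1 (chart_pt i z) * ev (mderiv j v.2) y) ->
  ~ finite_set [set z | critical_at p q i z v].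
Proof.
move=> a2 b2 crit ind grady fin; have gradx := critical_at_gradient crit.
case: crit => f0 g0 _; have xi := chart_pt_i i z.
set x := chart_pt i z in f0 g0 ind grady gradx xi.
pose w (s : K) := x + s *: (y - x).
have wE s : w s = (1 - s) *: x + s *: y.
  by apply/rowP => j; rewrite /w !mxE; ring.
have gradw s j : p%:R * ev v.2 x * ev (mderiv j v.1) (w s) =
    q%:R * ev v.1 x * ev (mderiv j v.2) (w s).
  rewrite wE (ev_homog_affine _ _ _ (homog_mderiv j (dhomogF v))); last first.
    by case: a a2 => [|[|[]]].
  rewrite (ev_homog_affine _ _ _ (homog_mderiv j (dhomogG v))); last first.
    by case: b b2 => [|[|[]]].
  transitivity ((1 - s) * (p%:R * ev v.2 x * ev (mderiv j v.1) x) +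
    s * (p%:R * ev v.2 x * ev (mderiv j v.1) y)); first by ring.
  by rewrite gradx grady; ring.
(* Euler's identity turns the proportional gradients along the line into proportional values. *)
have valw s : ev v.2 (w s) * ev v.1 x = ev v.2 x * ev v.1 (w s).
  have pa0 : p%:R * a%:R != 0 :> K by rewrite -natrM pnatr_eq0 muln_eq0 !eqn0Ngt p0 a0.
  have Ea := euler_identity (w s) (dhomogF v).
  have Eb := euler_identity (w s) (dhomogG v).
  apply: (mulfI pa0); rewrite [in LHS]paqb.
  transitivity (q%:R * ev v.1 x * (b%:R * ev v.2 (w s))); first by ring.
  rewrite -Eb; transitivity (p%:R * ev v.2 x * (a%:R * ev v.1 (w s))); last by ring.
  rewrite -Ea !mulr_sumr; apply: eq_bigr => j _.
  by rewrite mulrCA -gradw; ring.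
have [P PE] := polyfun_line x (y - x) (polyfun_ev_row v.1).
have [Q QE] := polyfun_line x (y - x) (polyfun_lin (@scalar_coef K n.+1 i)).
(* [P] is the first form and [Q] the i-th coordinate along the line. Neither vanishes at [x], so all
   but finitely many points of the line lie in the chart and off the hypersurface of that form. *)
have P0 : P * Q != 0.
  apply: contraNneq f0 => PQ0; have := PE 0; have := QE 0.
  rewrite scale0r addr0 xi => Q1 ->.
  by rewrite -[P.[0]]mulr1 Q1 -hornerM PQ0 horner0.
pose S := [set s | (P * Q).[s] != 0].
pose zeta s := \row_k ((w s 0 i)^-1 * w s 0 (lift i k)).
apply: (infinite_numField (K := K)).
have -> : [set: K] = [set s | (P * Q).[s] = 0] `|` S.
  by apply/seteqP; split=> // s _; have [|] := eqVneq (P * Q).[s] 0; [left|right].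
rewrite finite_setU; split; first exact: finite_roots.
have SE s : S s -> ev v.1 (w s) != 0 /\ w s 0 i != 0.
  by rewrite /S /= hornerM mulf_eq0 negb_or PE QE => /andP.
have critS s : S s -> critical_at p q i (zeta s) v.
  move=> Ss; have [fs ws] := SE s Ss.
  apply: gradient_critical_at => //.
    apply/negP => /eqP gs; have /eqP := valw s.
    by rewrite gs mul0r eq_sym mulf_eq0 (negPf fs) (negPf g0).
  move=> j; apply: (mulfI f0).
  transitivity (p%:R * (ev v.2 (w s) * ev v.1 x) * ev (mderiv j v.1) (w s)); first by ring.
  rewrite valw; transitivity (ev v.1 (w s) *
    (p%:R * ev v.2 x * ev (mderiv j v.1) (w s))); first by ring.
  by rewrite gradw; ring.
have zeta_inj s t : S s -> S t -> zeta s = zeta t -> s = t.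
  move=> /SE[_ ws] /SE[_ wt] zst; have [j [k jk]] := ind.
  have prop l : w s 0 l * w t 0 i = w t 0 l * w s 0 i.
    case: (unliftP i l) => [l' ->|-> //]; last by rewrite mulrC.
    have zE r : zeta r 0 l' = (w r 0 i)^-1 * w r 0 (lift i l') by rewrite mxE.
    have := congr1 (fun u : 'rV[K]_n => u 0 l') zst; rewrite !zE => E.
    by rewrite -[X in X * _ = _](mulVKf ws) E; field.
  have : (w s 0 j * w t 0 k - w s 0 k * w t 0 j) * (w s 0 i * w t 0 i) = 0.
    transitivity ((w s 0 j * w t 0 i) * (w t 0 k * w s 0 i) -
      (w s 0 k * w t 0 i) * (w t 0 j * w s 0 i)); first by ring.
    by rewrite !prop; ring.
  move/eqP; rewrite mulf_eq0 (negPf (mulf_neq0 ws wt)) orbF => /eqP E.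
  have : (t - s) * (x 0 j * y 0 k - x 0 k * y 0 j) = 0.
    by rewrite -E !wE !mxE; ring.
  move/eqP; rewrite mulf_eq0 !subr_eq0 (negPf jk) orbF => /eqP ->//.
(* A left inverse of [zeta] on [S]; it exhibits [S] as part of the image of the critical set. *)
pose h z := xget 0 [set s | S s /\ zeta s = z].
apply: (@sub_finite_set _ _ (h @` [set z | critical_at p q i z v])); last first.
  exact: finite_image.
move=> s Ss; exists (zeta s); first exact: critS.
rewrite /h; case: xgetP => [t _ [St tz]|/(_ s)[]//].
exact: zeta_inj.
Qed.

(** The gradients are constant, so every point qualifies as the second point of [critical_line]; a
    coordinate vector other than the i-th is independent of the first. *)
Lemma linear_critical_infinite i z v : (0 < n)%N -> (a <= 1)%N -> (b <= 1)%N ->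
  critical_at p q i z v -> ~ finite_set [set z | critical_at p q i z v].
Proof.
move=> n0 a1 b1 crit; pose k : 'I_n := Ordinal n0.
apply: (critical_line (y := delta_mx 0 (lift i k)) _ _ crit).
- exact: leq_trans a1 _.
- exact: leq_trans b1 _.
- exists i, (lift i k); rewrite chart_pt_i !mxE !eqxx /= (negPf (neq_lift _ _)).
  by rewrite mulr0 mulr1 oner_neq0.
have cst d (P : mpoly n.+1 K) y y' : (d <= 1)%N -> P \is homog d ->
    forall j, ev (mderiv j P) y = ev (mderiv j P) y'.
  move=> d1 hP j; suff H u : ev (mderiv j P) u = ev (mderiv j P) 0 by rewrite H [RHS]H.
  have := homog_mderiv j hP; rewrite (_ : d.-1 = 0%N); last by case: d d1 {hP} => [|[]].
  by move/(ev_homogZ 0 u); rewrite scale0r expr0 mul1r.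
move=> j; rewrite (cst _ _ _ (chart_pt i z) a1 (dhomogF v)).
by rewrite (cst _ _ _ (chart_pt i z) b1 (dhomogG v)) critical_at_gradient.
Qed.

(** Representatives of the second point may be rescaled: for a suitable [c], both forms at [c *: y]
    are the same multiple of their values at [x], and [critical_line] applies. *)
Lemma equal_values_infinite i i' v : coprime p q -> (a <= 2)%N -> (b <= 2)%N ->
  equal_values p q i i' v -> exists z,
    critical_at p q i z v /\ ~ finite_set [set z | critical_at p q i z v].
Proof.
move=> pq a2 b2 [z [z' [ind crit crit' val]]]; exists z; split=> //.
have [f0 g0 _] := crit; have [f0' g0' _] := crit'.
have gradx := critical_at_gradient crit; have grady := critical_at_gradient crit'.
set x := chart_pt i z in f0 g0 ind val gradx.
set y := chart_pt i' z' in f0' g0' ind val grady.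
have [mu mu0 [fy gy]] := proportional_values p0 pq f0 g0 f0' g0' val.
(* If [a = b] then [p = q]. Otherwise the degrees are 1 and 2, and coprimality forces [q = a] and
   [p = b]. *)
have [c c0 cE] : exists2 c : K, c != 0 & c ^+ a * mu ^+ q = c ^+ b * mu ^+ p.
  have [ab|nab] := eqVneq a b.
    exists 1; rewrite ?oner_neq0// !expr1n !mul1r; congr (_ ^+ _).
    by move: abpq b0; rewrite ab => /eqP; rewrite eqn_pmul2l// => /eqP.
  exists mu^-1; first by rewrite invr_eq0.
  move: abpq pq a0 b0 a2 b2 nab; case: a => [|[|[|]]]//; case: b => [|[|[|]]]//.
    rewrite mul1n => -> + _ _ _ _ _; rewrite /coprime gcdnC gcdnMl => /eqP -> .
    by rewrite expr1; field.
  rewrite mul1n => <- + _ _ _ _ _; rewrite /coprime gcdnMl => /eqP -> .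
  by rewrite expr1; field.
apply: (critical_line (y := c *: y) a2 b2 crit).
  have [j [k jk]] := ind; exists j, k.
  by rewrite ![(c *: y) _ _]mxE mulrCA [X in _ != X]mulrCA (inj_eq (mulfI c0)).
move=> j; rewrite -/x (ev_homogZ _ _ (homog_mderiv j (dhomogF v))).
rewrite (ev_homogZ _ _ (homog_mderiv j (dhomogG v))).
have caq : c ^+ a * mu ^+ q != 0 by rewrite mulf_neq0 ?expf_neq0.
apply: (mulfI c0); apply: (mulfI caq).
transitivity (c ^+ a * (c * c ^+ a.-1) * mu ^+ q * p%:R * ev v.2 x * ev (mderiv j v.1) y).
  by ring.
rewrite -exprS prednK//.
transitivity (c ^+ a * (c ^+ a * mu ^+ q) * p%:R * ev v.2 x * ev (mderiv j v.1) y).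
  by ring.
rewrite [in LHS]cE; transitivity (c ^+ a * c ^+ b *
  (p%:R * ev v.2 y * ev (mderiv j v.1) y)); first by rewrite gy; ring.
have -> : c ^+ b = c * c ^+ b.-1 by rewrite -exprS prednK.
rewrite grady fy; ring.
Qed.

(** Fix [y0] with [f (_, y0)] not identically zero. Where this is nonzero, [f (v, _)] is a nonzero
    polynomial that vanishes at the k-th coordinate of every critical point, so this coordinate
    takes finitely many values. *)
Lemma thin_infinite i :
  thin [set v : PA * PB | ~ finite_set [set z | critical_at p q i z v]].
Proof.
pose A k := [set v : PA * PB |
  ~ finite_set [set z 0 k | z in [set z | critical_at p q i z v]]].
apply: (@thinS _ _ _ [set v | exists k, A k v]).
  move=> v /= ninf; apply: contrapT => nA; apply: ninf; apply: finite_row_set => k.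
  by apply: contrapT => Ak; apply: nA; exists k.
apply: thin_bigcup => k.
have [f [pf [[v0 y0] f0] fB]] := thin_critical_coordinate K p a0 b0 q0 i k.
exists (fun v : PA * PB => f (v, y0)); split.
- have := @polyfun_affine K _ _ (fun v : PA * PB => (v, 0 : K^o)) (0, y0) f.
  rewrite (_ : (fun w => f _) = fun v => f (v, y0)); first apply => //.
    by move=> c u w; congr (_, _); rewrite /= scaler0 addr0.
  by apply/funext => v; congr f; congr (_, _); rewrite /= ?add0r ?addr0.
- by exists v0.
- move=> v Av; apply: contrapT => /eqP fv; apply: Av.
  have [P PE] := polyfun_line (v, 0 : K^o) (0 : PA * PB, 1 : K^o) pf.
  have PE' s : f (v, s) = P.[s].
    rewrite -PE; congr f; congr (_, _); first by rewrite /= scaler0 addr0.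
    by rewrite /= add0r; exact/esym/mulr1.
  have P0 : P != 0 by apply: contraNneq fv => P0; rewrite PE' P0 horner0.
  apply: sub_finite_set (finite_roots P0) => _ [z cz <-] /=.
  by rewrite -PE'; apply: fB; exists z.
Qed.

End SmallDegree.

(** * Generic pairs of forms *)

Section Generic.
Variables (K : numFieldType) (n a b p q : nat).
Local Notation PA := (dhomog n.+1 K a).
Local Notation PB := (dhomog n.+1 K b).
Hypotheses (n0 : (0 < n)%N) (a0 : (0 < a)%N) (b0 : (0 < b)%N).
Hypotheses (p0 : (0 < p)%N) (q0 : (0 < q)%N).
Hypotheses (pq : coprime p q) (abpq : (a * p = b * q)%N).

Definition generic_pair (v : PA * PB) := forall i,
  [/\ ~ singular_in_chart i v.1, ~ singular_in_chart i v.2, ~ tangent_in_chart i v &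
   [/\ finite_set [set z | critical_at p q i z v], ~ degenerate p q i v &
       forall i', ~ equal_values p q i i' v]].

Lemma thin_nongeneric : thin [set v | ~ generic_pair v].
Proof.
pose fin i (v : PA * PB) := ~ finite_set [set z | critical_at p q i z v].
have tdeg i : thin (@degenerate K n a b p q i).
  have [ab|] := pselect ((1 < a)%N \/ (1 < b)%N).
    by case: n n0 i => // m _ i; exact: thin_degenerate.
  move=> /not_orP[/negP + /negP]; rewrite -!leqNgt => a1 b1.
  apply: thinS (thin_infinite K p a0 b0 q0 i) => // v [z [u [crit _ _]]].
  exact: (linear_critical_infinite a0 b0 p0 abpq n0 a1 b1 crit).
have teq i i' : thin (@equal_values K n a b p q i i').
  have [ab|] := pselect ((2 < a)%N \/ (2 < b)%N).
    exact: thin_equal_values.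
  move=> /not_orP[/negP + /negP]; rewrite -!leqNgt => a2 b2.
  apply: thinS (thin_infinite K p a0 b0 q0 i) => // v.
  by move=> /(equal_values_infinite a0 b0 p0 abpq pq a2 b2)[z []].
have tB i : thin [set v : PA * PB | ~
    [/\ ~ singular_in_chart i v.1, ~ singular_in_chart i v.2, ~ tangent_in_chart i v &
     [/\ finite_set [set z | critical_at p q i z v], ~ degenerate p q i v &
         forall i', ~ equal_values p q i i' v]]].
  have t1 : thin [set v : PA * PB | singular_in_chart i v.1].
    apply: (@thin_preimage _ _ _ (fun v : PA * PB => v.1)) (thin_singular K i a0) => // w.
    by exists (w, 0).
  have t2 : thin [set v : PA * PB | singular_in_chart i v.2].
    apply: (@thin_preimage _ _ _ (fun v : PA * PB => v.2)) (thin_singular K i b0) => // w.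
    by exists (0, w).
  apply: thinS (thinU t1 (thinU t2 (thinU (thin_tangent K a0 b0 i) (thinU
    (thin_infinite K p a0 b0 q0 i) (thinU (tdeg i) (thin_bigcup (teq i))))))) => //.
  move=> v nv; apply: contrapT; do !move=> /not_orP[?]; move=> nE; apply: nv.
  by split=> //; split=> //; [exact: contrapT|move=> i' ev; apply: nE; exists i'].
apply: thinS (thin_bigcup tB) => v ng; apply: contrapT => nE; apply: ng => i.
by apply: contrapT => H; apply: nE; exists i.
Qed.

End Generic.

(** * Calculus in charts *)

Section ChartCalculus.
Variables (K : numFieldType) (n : nat) (i : 'I_n.+1).
Implicit Types (P : mpoly n.+1 K) (z v : 'rV[K]_n).

Definition in_chart P z : K := ev P (chart_pt i z).

Definition chart_diff P z v : K := \sum_k v 0 k * in_chart (pd i k P) z.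

(** Agreement of analytic and formal derivatives, stated as a predicate so that it passes from
    constants and variables to sums and products. *)
Let differentiates P := forall z, differentiable (in_chart P) z /\
  forall v, 'D_v (in_chart P) z = chart_diff P z v.

Let differentiatesC c : differentiates (mpolyC _ c).
Proof.
move=> z; rewrite (_ : in_chart _ = cst c); last first.
  by apply/funext => y; rewrite /in_chart evC.
split=> // v; rewrite derive_cst /chart_diff big1// => k _.
by rewrite /in_chart pd_mderiv mderivC ev_meval meval0 mulr0.
Qed.

Let differentiatesU j : differentiates (mpolyX K (mnm1 j)).
Proof.
have U j' : mpolyX K (mnm1 j') = lform (fun l => (l == j')%:R).
  rewrite /lform (bigD1 j')//= eqxx scale1r big1 ?addr0// => l /negPf ->.
  by rewrite scale0r.
move=> z; case: (unliftP i j) => [k ->|->].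
  have E : in_chart (mpolyX K (mnm1 (lift i k))) = (fun y : 'rV[K]_n => y 0 k).
    by apply/funext => y; rewrite /in_chart ev_meval mevalXU chart_pt_lift.
  rewrite E; split; first exact: differentiable_coord.
  move=> v; rewrite deriveE; last exact: differentiable_coord.
  pose L : {scalar 'rV[K]_n} := HB.pack (fun y : 'rV[K]_n => y 0 k)
    (GRing.isLinear.Build K 'rV[K]_n K _ _ (@scalar_coef K n k)).
  rewrite (diff_lin (f := L)); last exact: coord_continuous.
  rewrite /chart_diff (bigD1 k)//= big1 ?addr0 => [|l lk].
    rewrite /in_chart U pd_lform evC eqxx mulr1.
    by [].
  by rewrite /in_chart U pd_lform evC (inj_eq lift_inj) (negPf lk) mulr0.
rewrite (_ : in_chart _ = cst 1); last first.
  by apply/funext => y; rewrite /in_chart ev_meval mevalXU chart_pt_i.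
split=> // v; rewrite derive_cst /chart_diff big1// => k _.
rewrite /in_chart U pd_lform evC eq_sym (negPf (neq_lift _ _)) mulr0 //.
Qed.

Let differentiatesD P Q : differentiates P -> differentiates Q -> differentiates (P + Q).
Proof.
move=> dP dQ z; have [dPz DP] := dP z; have [dQz DQ] := dQ z.
rewrite (_ : in_chart _ = in_chart P + in_chart Q); last first.
  by apply/funext => y; rewrite /in_chart evD.
split; first exact: differentiableD.
move=> v; rewrite deriveD ?DP ?DQ; try exact: diff_derivable.
rewrite /chart_diff -big_split; apply: eq_bigr => k _ /=.
by rewrite -mulrDr /in_chart pdD evD.
Qed.

Let differentiatesM P Q : differentiates P -> differentiates Q -> differentiates (P * Q).
Proof.
move=> dP dQ z; have [dPz DP] := dP z; have [dQz DQ] := dQ z.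
rewrite (_ : in_chart _ = in_chart P * in_chart Q); last first.
  by apply/funext => y; rewrite /in_chart evM.
split; first exact: differentiableM.
move=> v; rewrite deriveM ?DP ?DQ; try exact: diff_derivable.
rewrite /chart_diff !scaler_sumr -big_split; apply: eq_bigr => k _ /=.
by rewrite /in_chart pdM evD !evM /GRing.scale /=; ring.
Qed.

Let differentiates_all P : differentiates P.
Proof.
elim/mpolyind: P => [|c m P _ _ dP].
  by have := differentiatesC 0; rewrite mpolyC0.
apply: differentiatesD => //; rewrite -mul_mpolyC; apply: differentiatesM => //.
rewrite mpolyXE_id; elim/big_ind: _ => // [|j _].
  by have := differentiatesC 1; rewrite mpolyC1.
elim: (m j) => [|k IH].
  by rewrite expr0; have := differentiatesC 1; rewrite mpolyC1.
by rewrite exprS; apply: differentiatesM => //; exact: differentiatesU.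
Qed.

Lemma differentiable_in_chart P z : differentiable (in_chart P) z.
Proof. by have [] := differentiates_all P z. Qed.

Lemma derive_in_chart P z v : 'D_v (in_chart P) z = chart_diff P z v.
Proof. by have [] := differentiates_all P z. Qed.

Lemma diff_in_chart P z v : 'd (in_chart P) z v = chart_diff P z v.
Proof. by rewrite -deriveE ?derive_in_chart//; exact: differentiable_in_chart. Qed.

Lemma chart_diff_delta P z k : chart_diff P z (delta_mx 0 k) = in_chart (pd i k P) z.
Proof.
rewrite /chart_diff (bigD1 k)//= mxE !eqxx mul1r big1 ?addr0// => l /negPf lk.
by rewrite mxE lk andbF mul0r.
Qed.

Variables (p q : nat) (F G : mpoly n.+1 K).
Hypotheses (p0 : (0 < p)%N) (q0 : (0 < q)%N).

Definition chart_ratio z : K := in_chart F z ^+ p / in_chart G z ^+ q.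

(** What all partial derivatives of the quotient have in common; it is nonzero off both
    hypersurfaces. *)
Let chart_factor z : K := in_chart F z ^+ p.-1 / in_chart G z ^+ q.+1.

Let differentiable_power P k z : differentiable (fun y => in_chart P y ^+ k) z.
Proof.
rewrite (_ : (fun _ => _) = in_chart (P ^+ k)); first exact: differentiable_in_chart.
by apply/funext => y; rewrite /in_chart evX.
Qed.

Let derivable_quotient k l z : in_chart G z != 0 ->
  differentiable (fun y => in_chart F y ^+ k / in_chart G y ^+ l) z.
Proof.
move=> Gz; apply: differentiableM; first exact: differentiable_power.
by apply: differentiableV; [exact: differentiable_power|rewrite expf_neq0].
Qed.

Lemma differentiable_chart_ratio z : in_chart G z != 0 -> differentiable chart_ratio z.
Proof. exact: derivable_quotient. Qed.

Lemma derive_chart_ratio z v : in_chart G z != 0 ->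
  'D_v chart_ratio z = chart_factor z *
    (p%:R * in_chart G z * chart_diff F z v - q%:R * in_chart F z * chart_diff G z v).
Proof.
move=> Gz; rewrite (_ : chart_ratio =
  (in_chart F ^+ p) * (fun y => ((in_chart G ^+ q) y)^-1)); last first.
  by apply/funext => y; rewrite /chart_ratio /= !fctE.
have dF : derivable (in_chart F) z v by exact/diff_derivable/differentiable_in_chart.
have dG : derivable (in_chart G) z v by exact/diff_derivable/differentiable_in_chart.
have Gq : (in_chart G ^+ q) z != 0 by rewrite fctE expf_neq0.
have dFp : derivable (in_chart F ^+ p) z v by exact: derivableX.
have dGq : derivable (in_chart G ^+ q) z v by exact: derivableX.
have dGqV : derivable (fun y => ((in_chart G ^+ q) y)^-1) z v by exact: derivableV.
rewrite (deriveM dFp dGqV) (deriveV Gq dGq).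
rewrite !deriveX// !derive_in_chart /chart_factor /GRing.scale /= !fctE.
case: p p0 => // p' _; case: q q0 => // q' _ /=.
rewrite !exprS; field.
by rewrite Gz expf_neq0.
Qed.

Lemma derive_chart_ratio_delta z k : in_chart G z != 0 ->
  'D_(delta_mx 0 k) chart_ratio z =
  chart_factor z * in_chart (critical_form p q i k F G) z.
Proof.
move=> Gz; rewrite derive_chart_ratio// !chart_diff_delta; congr (_ * _).
by rewrite /critical_form /in_chart evB !evZ !evM; ring.
Qed.

(** In the product rule the derivative of [chart_factor] is multiplied by a critical form, which
    vanishes at [z]. *)
Lemma hessian_critical z : in_chart G z != 0 ->
  (forall k, in_chart (critical_form p q i k F G) z = 0) ->
  \matrix_(j, k) 'D_(delta_mx 0 j) ('D_(delta_mx 0 k) chart_ratio) z =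
  chart_factor z *: \matrix_(j, k) in_chart (pd i j (critical_form p q i k F G)) z.
Proof.
move=> Gz crit; apply/matrixP => j k; rewrite !mxE.
(* The formula for the first derivative gets differentiated, so it must hold on a neighbourhood of
   [z]. *)
have nearG : \forall y \near z, in_chart G y != 0.
  have /differentiable_continuous Gc := differentiable_in_chart G z.
  apply: (Gc [set x | x != 0]); exists `|in_chart G z|; first by rewrite /= normr_gt0.
  move=> y; rewrite /= => yltfx.
  by apply/eqP => y0; move: yltfx; rewrite y0 subr0 ltxx.
rewrite (near_eq_derive (g := chart_factor * in_chart (critical_form p q i k F G))); last first.
  by near do rewrite derive_chart_ratio_delta//.
rewrite deriveM.
- by rewrite crit scale0r addr0 derive_in_chart chart_diff_delta.
- by apply: diff_derivable; exact: derivable_quotient.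
- by apply: diff_derivable; exact: differentiable_in_chart.
Unshelve. all: by end_near.
Qed.

End ChartCalculus.

Lemma critical_form_at (K : numFieldType) n a b p q i k z
    (v : dhomog n.+1 K a * dhomog n.+1 K b) :
  critical_at p q i z v -> in_chart i (critical_form p q i k v.1 v.2) z = 0.
Proof.
move=> [_ _ crit]; rewrite /in_chart /critical_form evB !evZ !evM.
by rewrite mulrA crit mulrA subrr.
Qed.

(** * Topology of the coefficients *)

Section CoefficientTopology.
Variables (R : realType) (n : nat).
Local Notation K := (cplx R).

Lemma open_nonzero : open [set x : K | x != 0].
Proof.
rewrite openE => x x0; exists `|x|; first by rewrite /= normr_gt0.
by move=> y; rewrite /= => yx; apply/eqP => y0; move: yx; rewrite y0 subr0 ltxx.
Qed.

Lemma continuous_add (X : topologicalType) (f g : X -> K) :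
  continuous f -> continuous g -> continuous (fun x => f x + g x).
Proof. by move=> cf cg x; apply: cvgD; [exact: cf|exact: cg]. Qed.

Lemma continuous_mul (X : topologicalType) (f g : X -> K) :
  continuous f -> continuous g -> continuous (fun x => f x * g x).
Proof. by move=> cf cg x; apply: cvgM; [exact: cf|exact: cg]. Qed.

Lemma continuous_pair (X Y Z : topologicalType) (f : X -> Y) (g : X -> Z) :
  continuous f -> continuous g -> continuous (fun x => (f x, g x)).
Proof. by move=> cf cg x; apply: cvg_pair; [exact: cf|exact: cg]. Qed.

Lemma continuous_prod_topology (X : topologicalType) (I : Type)
    (T : I -> topologicalType) (g : X -> prod_topology T) :
  (forall i, continuous (fun x => g x i)) -> continuous g.
Proof.
move=> cg x; apply/cvg_sup => i.
exact: (@continuous_comp_initial _ _ _ (fun f : forall i, T i => f i) g (cg i)).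
Qed.

Lemma mcoeff_continuous d (m : multinom n.+1) :
  continuous (fun F : homog_poly R n d => mcoeff m (mpoly_of_dhomog F)).
Proof.
pose T := prod_topology (fun _ : multinom n.+1 => K : topologicalType).
move=> F.
apply: (@continuous_comp (homog_poly R n d) T K (@coeffs R n d) (fun f : T => f m)).
  exact: initial_continuous.
exact: (@proj_continuous _ (fun _ : multinom n.+1 => K : topologicalType)).
Qed.

(** A linear form is a finite combination of coefficients, which are continuous by the choice of
    topology. *)
Lemma scalar_continuous d (l : dhomog n.+1 K d -> K) : scalar l ->
  continuous (l : homog_poly R n d -> K).
Proof.
move=> ll; pose L : {scalar dhomog n.+1 K d} := HB.pack l (GRing.isLinear.Build K _ K _ l ll).
(* The index covers all degrees up to [d]. In degrees below [d] the value of [X m] is irrelevant,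
   since the coefficient of [F] is zero. *)
pose X (m : bmultinom n.+1 d.+1) : dhomog n.+1 K d := indhomog d (mpolyX K (bmnm m)).
have lE F : l F = \sum_m mcoeff (bmnm m) (mpoly_of_dhomog F) * l (X m).
  have FE : F = \sum_m mcoeff (bmnm m) (mpoly_of_dhomog F) *: X m.
    apply/val_inj; rewrite /= raddf_sum /=.
    have sF : (mmeasure mdeg (mpoly_of_dhomog F) <= d.+1)%N.
      rewrite mmeasureE; apply/bigmax_leqP_seq => m mF _.
      by have /dhomogP := dhomog_is_dhomog F; move=> /(_ m mF) /= ->.
    rewrite [LHS](mpolywE sF); apply: eq_bigr => m _.
    rewrite ?linearZ /=; have [md|md] := eqVneq (mdeg (bmnm m)) d.
      by rewrite /X /indhomog insubdK// unfold_in /= dhomogX /= md.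
    rewrite (dhomog_nemf_coeff (mf := mdeg) (d := d)) ?scale0r//.
    exact: dhomog_is_dhomog.
  rewrite {1}FE -[l]/(L : _ -> K) linear_sum; apply: eq_bigr => m _.
  by rewrite linearZ.
rewrite (_ : l = fun F => \sum_m mcoeff (bmnm m) (mpoly_of_dhomog F) * l (X m)); last first.
  exact/funext.
apply: continuous_big => [|m _]; first exact: add_continuous.
apply: (@continuous_mul (homog_poly R n d)); first exact: mcoeff_continuous.
exact: cst_continuous.
Qed.

Variables (a b : nat).
Local Notation V := (dhomog n.+1 K a * dhomog n.+1 K b)%type.
Local Notation VT := (homog_poly R n a * homog_poly R n b)%type.

Lemma polyfun_continuous (f : V -> K) : polyfun f -> continuous (f : VT -> K).
Proof.
elim=> [c|l ll|{}f g _ cf _ cg|{}f g _ cf _ cg].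
- exact: (@cst_continuous VT).
- have lE (v : V) : l v = l (v.1, 0) + l (0, v.2).
    rewrite -[l (v.1, 0)]mul1r -ll; congr l.
    by case: v => v w; congr (_, _); rewrite /= ?scale1r ?addr0 ?scaler0 ?add0r.
  have l1 : scalar (fun F : dhomog n.+1 K a => l (F, 0)).
    by move=> c u w; rewrite -ll; congr l; congr (_, _); rewrite /= scaler0 addr0.
  have l2 : scalar (fun G : dhomog n.+1 K b => l (0, G)).
    by move=> c u w; rewrite -ll; congr l; congr (_, _); rewrite /= scaler0 addr0.
  rewrite (_ : l = fun v => l (v.1, 0) + l (0, v.2)); last exact/funext.
  apply: (@continuous_add VT) => v.
    apply: (@continuous_comp VT (homog_poly R n a) K fst (fun F => l (F, 0)) v).
      exact: cvg_fst.
    exact: (scalar_continuous l1).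
  apply: (@continuous_comp VT (homog_poly R n b) K snd (fun G => l (0, G)) v).
    exact: cvg_snd.
  exact: (scalar_continuous l2).
- exact (@continuous_add VT f g cf cg).
- exact (@continuous_mul VT f g cf cg).
Qed.

Lemma segment_continuous d (F H : dhomog n.+1 K d) :
  continuous (fun s : K => F + s *: H : homog_poly R n d).
Proof.
apply: continuous_comp_initial; apply: continuous_prod_topology => m.
rewrite (_ : (fun _ => _) = fun s : K =>
    mcoeff m (mpoly_of_dhomog F) + s * mcoeff m (mpoly_of_dhomog H)); last first.
  apply/funext => s; rewrite -mcoeffZ -mcoeffD.
  exact: (erefl (mcoeff m (mpoly_of_dhomog (F + s *: H)))).
apply: continuous_add; first exact: cst_continuous.
by apply: continuous_mul; [move=> s; exact: cvg_id|exact: cst_continuous].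
Qed.

(** For density, join a point of the given open set to a point where [f] is nonzero: along this line
    [f] has finitely many roots, while infinitely many small parameters stay in the open set. *)
Lemma thin_complement_open_dense (B : set V) : thin B ->
  exists U : set VT, [/\ open U, dense U & forall v, U v -> ~ B v].
Proof.
move=> [f [pf [w fw] fB]].
exists [set v : VT | f v != 0]; split=> [||v fv /fB E].
- have /continuousP cf := polyfun_continuous pf.
  exact: (cf [set x : K | x != 0] open_nonzero).
- move=> O [v Ov] oO.
  pose seg (s : K) : VT := (v.1 + s *: (w.1 - v.1), v.2 + s *: (w.2 - v.2)).
  have [P PE] := polyfun_line (v : V) (w - v : V) pf.
  have segE s : f (seg s) = P.[s] by rewrite -PE.
  have P0 : P != 0.
    apply: contraNneq fw => P0; rewrite (_ : w = seg 1).
      by rewrite segE P0 horner0.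
    by rewrite /seg !scale1r ![_ + (_ - _)]addrC !subrK -surjective_pairing.
  have : nbhs (0 : K) (seg @^-1` O).
    have cseg : continuous (seg : K -> VT).
      by apply: continuous_pair; exact: segment_continuous.
    apply: cseg; apply: open_nbhs_nbhs; split=> //.
    by rewrite /seg !scale0r !addr0 -surjective_pairing.
  move=> [e /= e0 eO]; apply: contrapT => H; apply: infinite_nat.
  (* A denominator of at least 2 keeps the parameter strictly below [e]. *)
  pose g (k : nat) : K := e / k.+2%:R.
  have gO k : O (seg (g k)).
    apply: eO; rewrite /= sub0r normrN ger0_norm ?divr_ge0 ?ltW//.
    by rewrite ltr_pdivrMr ?ltr0n// ltr_pMr// ltr1n.
  have : finite_set (g @^-1` [set x | P.[x] = 0]).
    apply: finite_preimage (finite_roots P0) => k l _ _ /(mulfI (lt0r_neq0 e0)) /invr_inj.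
    by move/eqP; rewrite eqr_nat => /eqP [].
  apply: (@sub_finite_set _ [set: nat]) => k _; apply: contrapT => /eqP Pk; apply: H.
  by exists (seg (g k)); split => //=; rewrite segE.
- by move: fv; rewrite /= E eqxx.
Qed.

End CoefficientTopology.

(** * From genericity to the geometry of F^p/G^q *)

Section GenericPairs.
Variables (R : realType) (n a b p q : nat).
Local Notation K := (cplx R).
Hypotheses (a0 : (0 < a)%N) (b0 : (0 < b)%N) (p0 : (0 < p)%N) (q0 : (0 < q)%N).
Hypothesis abpq : (a * p = b * q)%N.

Lemma dehomog_in_chart d (F : homog_poly R n d) i :
  dehomog F i = in_chart i (mpoly_of_dhomog F).
Proof. by apply/funext => z; rewrite /in_chart ev_meval. Qed.

Lemma smooth_of_nonsingular d (F : homog_poly R n d) :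
  (forall i, ~ @singular_in_chart K n d i F) -> smooth_hypersurface F.
Proof.
move=> ns i z /zero_locus_chart; rewrite dehomog_in_chart => Fz.
apply: contrapT => H; apply: (ns i); exists z; split=> // k.
apply: contrapT => /eqP Fk; apply: H; exists (delta_mx 0 k).
by rewrite diff_in_chart chart_diff_delta.
Qed.

Lemma scalar_chart_diff i (P : mpoly n.+1 K) z : scalar (chart_diff i P z).
Proof. by apply: scalar_sum => k c u v; rewrite !mxE; ring. Qed.

Variables (F : homog_poly R n a) (G : homog_poly R n b).
Local Notation v := ((F, G) : dhomog n.+1 K a * dhomog n.+1 K b).

(** Nonproportional differentials yield [u0] killed by that of [F] but not by that of [G];
    subtracting a multiple of [u0] moves any [w] into the tangent space of [G]. *)
Lemma transversal_of_nontangent :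
  (forall i, ~ @singular_in_chart K n a i F) ->
  (forall i, ~ tangent_in_chart i v) -> meet_transversally F G.
Proof.
move=> ns nt i z /zero_locus_chart + /zero_locus_chart.
rewrite /tangent_space !dehomog_in_chart => Fz Gz w.
pose f k := in_chart i (pd i k (mpoly_of_dhomog F)) z.
pose g k := in_chart i (pd i k (mpoly_of_dhomog G)) z.
have [k fk] : exists k, f k != 0.
  apply: contrapT => H; apply: (ns i); exists z; split=> // k.
  by apply: contrapT => /eqP Fk; apply: H; exists k.
have [l gl] : exists l, g l != g k / f k * f l.
  apply: contrapT => H; apply: (nt i); exists z, (g k / f k); split=> // l.
  by apply: contrapT => /eqP Fl; apply: H; exists l.
pose u0 : 'rV[K]_n := delta_mx 0 l - (f l / f k) *: delta_mx 0 k.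
have dP P : chart_diff i P z u0 =
    in_chart i (pd i l P) z - f l / f k * in_chart i (pd i k P) z.
  rewrite /u0 addrC -scaleNr scalar_chart_diff !chart_diff_delta.
  by rewrite mulNr addrC.
have dF : chart_diff i (mpoly_of_dhomog F) z u0 = 0.
  by rewrite dP -/(f l) -/(f k) divfK// subrr.
have dG : chart_diff i (mpoly_of_dhomog G) z u0 != 0.
  rewrite dP -/(g l) -/(g k) subr_eq0.
  by apply: contra_neq gl => ->; rewrite mulrAC [f l * _]mulrC -mulrA mulrAC mulrA.
pose c := chart_diff i (mpoly_of_dhomog G) z w / chart_diff i (mpoly_of_dhomog G) z u0.
exists (c *: u0), (w - c *: u0); split; last by rewrite addrC subrK.
  rewrite /= diff_in_chart -[c *: u0]addr0 scalar_chart_diff dF mulr0 add0r.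
  by rewrite /chart_diff big1// => j _; rewrite mxE mul0r.
rewrite /= diff_in_chart addrC -scaleNr scalar_chart_diff /c.
by rewrite mulNr divfK// addNr.
Qed.

Lemma ratio_chart_in_chart i :
  ratio_chart p q F G i = chart_ratio i p q (mpoly_of_dhomog F) (mpoly_of_dhomog G).
Proof.
apply/funext => z; rewrite /ratio_chart /chart ratio_map_pi//= /chart_ratio.
rewrite -!dehomog_in_chart /dehomog.
(* Where [G] vanishes both sides are 0: [affine_coord] is 0 at infinity, and so is the inverse of
   [0 ^+ q] as [q] is positive. *)
case: eqP => [->|//] /=.
by rewrite expr0n eqn0Ngt q0 invr0 mulr0.
Qed.

Lemma critical_points_chart i z : critical_points p q F G (chart i z) ->
  critical_at p q i z v.
Proof.
move=> [/zero_locus_chart Fz /zero_locus_chart Gz crit].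
rewrite dehomog_in_chart in Fz; rewrite dehomog_in_chart in Gz.
have Fz' := introN eqP Fz; have Gz' := introN eqP Gz.
split=> // k; have := crit i z erefl (delta_mx 0 k).
rewrite ratio_chart_in_chart -deriveE; last exact: differentiable_chart_ratio.
rewrite derive_chart_ratio// !chart_diff_delta => /eqP.
rewrite mulf_eq0 subr_eq0 => /orP[|/eqP//].
by rewrite mulf_eq0 invr_eq0 !expf_eq0 (negPf Fz') (negPf Gz') !andbF.
Qed.

Lemma nondegenerate_of_generic x : (forall i, ~ degenerate p q i v) ->
  critical_points p q F G x -> nondegenerate_at p q F G x.
Proof.
move=> nd crit i z zx; rewrite -zx in crit.
have cz := critical_points_chart crit; have [Fz Gz _] := cz.
rewrite /hessian ratio_chart_in_chart hessian_critical//; last first.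
  by move=> k; exact: (critical_form_at k cz).
rewrite detZ mulf_neq0 ?expf_neq0// ?mulf_neq0 ?invr_eq0 ?expf_neq0//.
apply/negP => /det0P[u u0 uM]; apply: (nd i); exists z, u; split=> // k.
have := congr1 (fun r : 'rV[K]_n => r 0 k) uM; rewrite !mxE => E.
by rewrite -[RHS]E; apply: eq_bigr => l _; rewrite mxE.
Qed.

Lemma finite_critical_points :
  (forall i, finite_set [set z | critical_at p q i z v]) ->
  finite_set (critical_points p q F G).
Proof.
move=> fin; apply: (@sub_finite_set _ _
  (\bigcup_(i in [set: 'I_n.+1]) (chart i @` [set z | critical_at p q i z v]))).
  move=> x; have [i [z <-]] := chart_cover x => crit; exists i => //.
  by exists z => //; exact: critical_points_chart.
by apply: bigcup_finite => // i _; exact: finite_image.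
Qed.

Lemma independent_charts i i' (z z' : 'rV[K]_n) : chart i z <> chart i' z' ->
  independent_points (chart_pt i z) (chart_pt i' z').
Proof.
move=> ne; apply: contrapT => nind; apply: ne.
apply/eqquotP/asboolP => /=.
set x := chart_pt i z in nind; set y := chart_pt i' z' in nind.
have minor j k : x 0 j * y 0 k = x 0 k * y 0 j.
  by apply: contrapT => /eqP jk; apply: nind; exists j, k.
have yE : y = y 0 i *: x.
  apply/rowP => k; rewrite [RHS]mxE mulrC -(minor i k).
  by rewrite [x 0 i]chart_pt_i mul1r.
exists (y 0 i) => //; apply/eqP => yi.
have := chart_pt_i i' z'; rewrite -/y yE yi scale0r mxE => /eqP.
by rewrite eq_sym oner_eq0.
Qed.

Lemma distinct_critical_values x y : (forall i i', ~ equal_values p q i i' v) ->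
  critical_points p q F G x -> critical_points p q F G y ->
  ratio_map p q F G x = ratio_map p q F G y -> x = y.
Proof.
move=> ne + + E; have [i [z zx]] := chart_cover x; have [i' [z' zy]] := chart_cover y.
rewrite -zx -zy in E *; move=> /critical_points_chart cx /critical_points_chart cy.
apply: contrapT => /independent_charts ind; apply: (ne i i'); exists z, z'.
split; [exact: ind|exact: cx|exact: cy|].
have [_ Gx _] := cx; have [_ Gy _] := cy.
move: E; rewrite /chart !ratio_map_pi//=.
have hE d (H : homog_poly R n d) i0 z0 : heval H (chart_vec i0 z0) =
    ev (mpoly_of_dhomog H) (chart_pt i0 z0) by rewrite ev_meval.
rewrite !hE (negPf Gx) (negPf Gy) => -[] /eqP.
by rewrite eqr_div ?expf_neq0// => /eqP.
Qed.

End GenericPairs.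

Theorem proposition0p1 (R : realType) (n a b p q : nat)
    (hn : (1 <= n)%N) (ha : (0 < a)%N) (hb : (0 < b)%N)
    (hp : (0 < p)%N) (hq : (0 < q)%N) (hpq : coprime p q)
    (hab : a%:R / b%:R = q%:R / p%:R :> rat) :
  exists U : set (homog_poly R n a * homog_poly R n b),
    [/\ open U, dense U &
      forall (F : homog_poly R n a) (G : homog_poly R n b), U (F, G) ->
        [/\ smooth_hypersurface F, smooth_hypersurface G, meet_transversally F G &
          exists (r : nat) (pt : 'I_r -> CP R n),
            [/\ range pt = critical_points p q F G,
                forall k, nondegenerate_at p q F G (pt k) &
                injective (ratio_map p q F G \o pt)]]].
Proof.
have abpq : (a * p = b * q)%N.
  apply/eqP; rewrite -(eqr_nat rat) !natrM; move/eqP: hab.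
  by rewrite eqr_div ?pnatr_eq0 -?lt0n// [b%:R * _]mulrC.
have [U [oU dU genU]] := thin_complement_open_dense
  (thin_nongeneric (cplx R) hn ha hb hp hq hpq abpq).
exists U; split=> // F G /genU/contrapT gen.
have [s1 [s2 [tg [fin [dg ev]]]]] :
    (forall i, ~ @singular_in_chart (cplx R) n a i F) /\
    (forall i, ~ @singular_in_chart (cplx R) n b i G) /\
    (forall i, ~ tangent_in_chart i ((F, G) : dhomog _ _ _ * dhomog _ _ _)) /\
    (forall i, finite_set [set z | critical_at p q i z (F, G)]) /\
    (forall i, ~ degenerate p q i (F, G)) /\
    (forall i i', ~ equal_values p q i i' (F, G)).
  by do !split; move=> i; have [? ? ? []] := gen i.
split; [exact: smooth_of_nonsingular|exact: smooth_of_nonsingular|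
  exact: transversal_of_nontangent|].
have /finite_seqP[s sE] := finite_critical_points hp hq abpq fin.
(* Without duplicates the enumeration is injective, so that equal values, which force equal points,
   force equal indices. *)
exists (size (undup s)), (tnth (in_tuple (undup s))).
have crit k : critical_points p q F G (tnth (in_tuple (undup s)) k).
  by rewrite sE /= -mem_undup; exact: mem_tnth.
split=> [|k|k l E].
- rewrite sE; apply/seteqP; split=> x /=.
    by move=> [k _ <-]; rewrite -mem_undup mem_tnth.
  by rewrite -mem_undup => /(tnthP (in_tuple _))[k ->]; exists k.
- exact: nondegenerate_of_generic.
- have /tuple_uniqP inj : uniq (in_tuple (undup s)) by exact: undup_uniq.
  exact/inj/(distinct_critical_values hp hq abpq ev (crit k) (crit l) E).
Qed.
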